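(* Let $A$ be a Fréchet locally $C^*$-algebra and let $E$ be a Hilbert $A$-module. Then $E$ is countably generated if and only if $K_A(E)$ has a countable approximate unit.
   Context: A locally $C^*$-algebra is a complete Hausdorff complex topological $*$-algebra $A$ whose topology is determined by its continuous $C^*$-seminorms: a net $(a_i)$ converges to $0$ iff $p(a_i)\to 0$ for every continuous $C^*$-seminorm $p$. $S(A)$ denotes the set of all continuous $C^*$-seminorms on $A$. A Fréchet locally $C^*$-algebra is a locally $C^*$-algebra whose topology is determined by a countable family of $C^*$-seminorms. For $p\in S(A)$, $A_p=A/\ker p$, a $C^*$-algebra, with quotient map $\pi_p$. An approximate unit of a locally $C^*$-algebra $B$ is an increasing net $\{e_i\}_{i\in I}$ of positive elements of $B$ with $p(e_i)\le 1$ for all $i\in I$, $p\in S(B)$, and $p(be_i-b)\to 0$, $p(e_ib-b)\to 0$ for all $p\in S(B)$, $b\in B$. It is countable if it is indexed by a countable set (e.g. is a sequence). A pre-Hilbert $A$-module is a complex vector space $E$ that is also a right $A$-module (compatible with the complex algebra structure), with an $A$-valued inner product $\langle\cdot,\cdot\rangle:E\times E\to A$ that is $\mathbb{C}$- and $A$-linear in the second variable and satisfies $\langle\xi,\eta\rangle^*=\langle\eta,\xi\rangle$, $\langle\xi,\xi\rangle\ge 0$, and $\langle\xi,\xi\rangle=0$ iff $\xi=0$. It is a Hilbert $A$-module if it is complete for the topology given by the seminorms $\overline{p}_E(\xi)=\sqrt{p(\langle\xi,\xi\rangle)}$, $p\in S(A)$. A subset $G\subseteq E$ is a generating set for $E$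 if the closed submodule of $E$ generated by $G$ is all of $E$; $E$ is countably generated if it has a countable generating set. $L_A(E)$ is the set of adjointable $A$-module homomorphisms $E\to E$. For $p\in S(A)$ let $\mathcal{E}_p=\{\xi\in E:p(\langle\xi,\xi\rangle)=0\}$ and $E_p=E/\mathcal{E}_p$, a Hilbert $A_p$-module with $\langle\xi+\mathcal{E}_p,\eta+\mathcal{E}_p\rangle=\pi_p(\langle\xi,\eta\rangle)$ and $(\xi+\mathcal{E}_p)\pi_p(a)=\xi a+\mathcal{E}_p$. Each $T\in L_A(E)$ induces $(\pi_p)_*(T)\in L_{A_p}(E_p)$ by $(\pi_p)_*(T)(\xi+\mathcal{E}_p)=T\xi+\mathcal{E}_p$. With the seminorms $\widetilde p(T)=\|(\pi_p)_*(T)\|$, $p\in S(A)$, $L_A(E)$ is a locally $C^*$-algebra. $K_A(E)$ (the ''compact'' operators) is the closure in $L_A(E)$ of the linear span of the operators $\theta_{\xi,\eta}$, $\theta_{\xi,\eta}(\zeta)=\xi\langle\eta,\zeta\rangle$, $\xi,\eta\in E$; it is a locally $C^*$-algebra. *)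

(* Defs.v *)
From HB Require Import structures.
From mathcomp Require Import all_boot all_order all_algebra.
From mathcomp Require Import complex.
From mathcomp Require Import all_classical all_reals all_analysis.

Set Implicit Arguments.
Unset Strict Implicit.
Unset Printing Implicit Defensive.

Import Order.TTheory GRing.Theory Num.Theory.
Import numFieldNormedType.Exports.

Local Open Scope classical_set_scope.
Local Open Scope complex_scope.
Local Open Scope ring_scope.

(* Complex *-algebras. They need not have a unit, so they are not built on the
   (unital) rings of ssralg. *)

HB.mixin Record Lmodule_isStarAlgebra (R : realType) A
    & GRing.Lmodule R[i] A := {
  amul : A -> A -> A ;
  astar : A -> A ;
  amulA : associative amul ;
  amulDl : left_distributive amul +%R ;
  amulDr : right_distributive amul +%R ;
  amulZl : forall (c : R[i]) a b, amul (c *: a) b = c *: amul a b ;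
  amulZr : forall (c : R[i]) a b, amul a (c *: b) = c *: amul a b ;
  astarK : involutive astar ;
  astarD : {morph astar : a b / a + b} ;
  astarZ : forall (c : R[i]) a, astar (c *: a) = c^* *: astar a ;
  astarM : forall a b, astar (amul a b) = amul (astar b) (astar a)
}.

#[short(type="starAlgType")]
HB.structure Definition StarAlgebra (R : realType) :=
  {A of GRing.Lmodule R[i] A & Lmodule_isStarAlgebra R A}.

Declare Scope star_scope.
Delimit Scope star_scope with star.
Local Open Scope star_scope.
Notation "a ** b" := (amul a b) (at level 40, left associativity) : star_scope.

(* No compatibility between the topology and the operations is required. *)
#[short(type="preTopStarAlgType")]
HB.structure Definition PreTopologicalStarAlgebra (R : realType) :=
  {A of PreTopologicalLmodule R[i] A & Lmodule_isStarAlgebra R A}.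

(* [B] is meant to be a *-subalgebra of [A], with the subspace topology; the
   algebra [A] itself is the case [B = setT]. A seminorm on [B] is represented
   by a function on [A] whose values outside [B] are irrelevant. *)
Section subalgebra_notions.
Context (R : realType).

Definition cstar_seminorm_on (A : starAlgType R) (B : set A) (p : A -> R) :=
  [/\ forall a, B a -> 0 <= p a,
      forall a b, B a -> B b -> p (a + b) <= p a + p b,
      forall (c : R[i]) a, B a -> p (c *: a) = Normc.normc c * p a,
      forall a b, B a -> B b -> p (a ** b) <= p a * p b
    & forall a, B a -> p (astar a ** a) = p a ^+ 2].

Definition continuous_cstar_seminorms_on (A : preTopStarAlgType R) (B : set A)
  : set (A -> R) :=
  [set p | cstar_seminorm_on B p /\ {within B, continuous p}].

(* In a (locally) C*-algebra these are the self-adjoint elements whose spectrum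
   is contained in [0, +oo[. *)
Definition positive_in (A : starAlgType R) (B : set A) (a : A) :=
  exists2 c, B c & a = astar c ** c.

End subalgebra_notions.

Notation cstar_seminorm := (cstar_seminorm_on setT).
Notation S_ A := (continuous_cstar_seminorms_on [set: A]).
Notation positive_elt := (positive_in setT).

(* Filters play the role of nets. In a topological vector space it is enough
   to have this at [x = 0]. *)
Definition topology_determined_by (R : realType) (V : preTopologicalLmodType R[i])
    (P : set (V -> R)) :=
  forall (F : set_system V) (x : V), Filter F ->
    F --> x <-> forall p, P p -> p (y - x) @[y --> F] --> (0 : R).

(* The Cauchy filters for the translation-invariant uniformity; the library's
   [cauchy] would need a uniformity given beforehand. *)
Definition tvs_complete (R : realType) (V : preTopologicalLmodType R[i]) :=
  forall F : set_system V, ProperFilter F ->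
    z.1 - z.2 @[z --> (F, F)] --> (0 : V) -> exists x : V, F --> x.

HB.mixin Record isLocallyCStar (R : realType) A
    & PreTopologicalStarAlgebra R A & TopologicalLmodule R[i] A := {
  amul_continuous : continuous (fun z : A * A => z.1 ** z.2) ;
  astar_continuous : continuous (astar : A -> A) ;
  lcstar_hausdorff : hausdorff_space A ;
  lcstar_complete : tvs_complete A ;
  lcstar_determined : topology_determined_by (S_ A)
}.

#[short(type="locallyCStarType")]
HB.structure Definition LocallyCStar (R : realType) :=
  {A of PreTopologicalStarAlgebra R A & TopologicalLmodule R[i] A
      & isLocallyCStar R A}.

Definition frechet (R : realType) (A : locallyCStarType R) :=
  exists P : set (A -> R),
    [/\ countable P, P `<=` [set p | cstar_seminorm p]
      & topology_determined_by P].

Section approximate_units.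
Context (R : realType).

Definition net_filter (I : Type) (le : I -> I -> Prop) : set_system I :=
  [set U | exists i0, forall i, le i0 i -> U i].

Definition directed (I : Type) (le : I -> I -> Prop) :=
  [/\ inhabited I, forall i, le i i,
      forall i j k, le i j -> le j k -> le i k
    & forall i j, exists k, le i k /\ le j k].

Definition approximate_unit (A : preTopStarAlgType R) (B : set A)
    (I : Type) (le : I -> I -> Prop) (e : I -> A) :=
  [/\ forall i, B (e i) /\ positive_in B (e i),
      forall i j, le i j -> positive_in B (e j - e i),
      forall i p, continuous_cstar_seminorms_on B p -> p (e i) <= 1
    & forall p b, continuous_cstar_seminorms_on B p -> B b ->
        p (b ** e i - b) @[i --> net_filter le] --> (0 : R) /\
        p (e i ** b - b) @[i --> net_filter le] --> (0 : R)].

Definition has_countable_approximate_unit (A : preTopStarAlgType R)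
    (B : set A) :=
  exists (I : Type) (le : I -> I -> Prop) (e : I -> A),
    [/\ directed le, countable [set: I] & approximate_unit B le e].

End approximate_units.

HB.mixin Record Lmodule_isPreHilbert (R : realType) (A : locallyCStarType R) E
    & GRing.Lmodule R[i] E := {
  ract : E -> A -> E ;
  ractDl : forall (x y : E) a, ract (x + y) a = ract x a + ract y a ;
  ractDr : forall (x : E) a b, ract x (a + b) = ract x a + ract x b ;
  ractM : forall (x : E) a b, ract x (a ** b) = ract (ract x a) b ;
  ractZl : forall (c : R[i]) (x : E) a, ract (c *: x) a = c *: ract x a ;
  ractZr : forall (c : R[i]) (x : E) a, ract x (c *: a) = c *: ract x a ;
  inner : E -> E -> A ;
  innerD : forall x y z : E, inner x (y + z) = inner x y + inner x z ;
  innerZ : forall (c : R[i]) (x y : E), inner x (c *: y) = c *: inner x y ;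
  innerM : forall (x y : E) a, inner x (ract y a) = inner x y ** a ;
  inner_star : forall x y : E, astar (inner x y) = inner y x ;
  inner_ge0 : forall x : E, positive_elt (inner x x) ;
  inner_eq0 : forall x : E, inner x x = 0 <-> x = 0
}.

#[short(type="preHilbertModType")]
HB.structure Definition PreHilbertModule (R : realType)
    (A : locallyCStarType R) :=
  {E of GRing.Lmodule R[i] E & Lmodule_isPreHilbert R A E}.

Section hilbert_seminorms.
Context (R : realType) (A : locallyCStarType R) (E : preHilbertModType A).

Definition bar_seminorm (p : A -> R) (x : E) : R := Num.sqrt (p (inner x x)).

End hilbert_seminorms.

HB.mixin Record isHilbertModule (R : realType) (A : locallyCStarType R) E
    & PreTopologicalLmodule R[i] E & PreHilbertModule R A E := {
  hilbert_determined : topology_determined_by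
    [set (bar_seminorm p : E -> R) | p in S_ A] ;
  hilbert_complete : tvs_complete E
}.

#[short(type="hilbertModType")]
HB.structure Definition HilbertModule (R : realType)
    (A : locallyCStarType R) :=
  {E of PreTopologicalLmodule R[i] E & PreHilbertModule R A E
      & isHilbertModule R A E}.

Section generating_sets.
Context (R : realType) (A : locallyCStarType R) (E : hilbertModType A).

Definition closed_submodule (M : set E) :=
  [/\ closed M, M 0, forall x y, M x -> M y -> M (x + y),
      forall (c : R[i]) x, M x -> M (c *: x)
    & forall x (a : A), M x -> M (ract x a)].

Definition generated_closed_submodule (G : set E) : set E :=
  \bigcap_(M in [set M | closed_submodule M /\ G `<=` M]) M.

Definition generating_set (G : set E) := generated_closed_submodule G = setT.

Definition countably_generated :=
  exists2 G : set E, countable G & generating_set G.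

End generating_sets.

Arguments countably_generated {R A} E.

Section adjointable_operators.
Context (R : realType) (A : locallyCStarType R) (E : preHilbertModType A).

Definition is_adjoint (T S : E -> E) :=
  forall x y, inner (T x) y = inner x (S y).

Definition is_adjointable (T : E -> E) :=
  [/\ linear T, forall x (a : A), T (ract x a) = ract (T x) a
    & exists S, is_adjoint T S].

Record adjointable := Adjointable {
  adj_fun :> E -> E ;
  adj_funP : is_adjointable adj_fun
}.

Lemma adjointable_eq (T S : adjointable) : T =1 S -> T = S.
Proof.
case: T S => [T TP] [S SP] /= /funext TS.
by case: _ / TS SP => SP; congr Adjointable; exact: Prop_irrelevance.
Qed.

Lemma innerDl (x y z : E) : inner (x + y) z = inner x z + inner y z.
Proof. by rewrite -inner_star innerD astarD !inner_star. Qed.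

Lemma innerZl (c : R[i]) (x y : E) : inner (c *: x) y = c^* *: inner x y.
Proof. by rewrite -inner_star innerZ astarZ inner_star. Qed.

Lemma innerMl (x y : E) (a : A) : inner (ract x a) y = astar a ** inner x y.
Proof. by rewrite -inner_star innerM astarM inner_star. Qed.

Lemma inner_inj (x y : E) : (forall z, inner z x = inner z y) -> x = y.
Proof.
move=> xy; apply/eqP; rewrite -subr_eq0; apply/eqP/inner_eq0.
by rewrite innerD -scaleN1r innerZ xy !scaleN1r subrr.
Qed.

Lemma is_adjointC (T S : E -> E) : is_adjoint T S -> is_adjoint S T.
Proof. by move=> TS x y; rewrite -inner_star -TS inner_star. Qed.

Lemma is_adjoint_adjointable (T S : E -> E) :
  is_adjoint T S -> is_adjointable T.
Proof.
move=> TS; have ST := is_adjointC TS; split; last by exists S.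
  move=> c x y; apply: inner_inj => z.
  by rewrite innerD innerZ -!ST innerD innerZ.
by move=> x a; apply: inner_inj => z; rewrite innerM -!ST innerM.
Qed.

Lemma adjoint_exists (T : adjointable) :
  exists S : adjointable, is_adjoint T S.
Proof.
have [_ _ [S TS]] := adj_funP T.
by exists (Adjointable (is_adjoint_adjointable (is_adjointC TS))).
Qed.

Definition adjoint (T : adjointable) : adjointable :=
  projT1 (cid (adjoint_exists T)).

Lemma adjointP (T : adjointable) : is_adjoint T (adjoint T).
Proof. exact: projT2 (cid (adjoint_exists T)). Qed.

Lemma adjoint_uniq (T S : adjointable) : is_adjoint T S -> adjoint T = S.
Proof.
move=> TS; apply: adjointable_eq => x; apply: inner_inj => z.
by rewrite -adjointP TS.
Qed.

Definition mk_adjointable (T S : E -> E) (TS : is_adjoint T S) : adjointable :=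
  Adjointable (is_adjoint_adjointable TS).

Lemma adj_zeroP : is_adjoint (fun=> 0 : E) (fun=> 0).
Proof.
by move=> x y; rewrite -(scale0r (0 : E)) innerZl innerZ rmorph0 !scale0r.
Qed.

Lemma adj_addP (T S : adjointable) : is_adjoint (fun x => T x + S x)
  (fun x => adjoint T x + adjoint S x).
Proof. by move=> x y; rewrite innerDl innerD !adjointP. Qed.

Lemma adj_scaleP (c : R[i]) (T : adjointable) : is_adjoint (fun x => c *: T x)
  (fun x => c^* *: adjoint T x).
Proof. by move=> x y; rewrite innerZl innerZ adjointP. Qed.

Lemma adj_compP (T S : adjointable) : is_adjoint (fun x => T (S x))
  (fun x => adjoint S (adjoint T x)).
Proof. by move=> x y; rewrite !adjointP. Qed.

Lemma thetaP (x y : E) : is_adjoint (fun z => ract x (inner y z))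
  (fun z => ract y (inner x z)).
Proof. by move=> z w; rewrite innerMl innerM inner_star. Qed.

Definition adj_zero := mk_adjointable adj_zeroP.
Definition adj_add T S := mk_adjointable (adj_addP T S).
Definition adj_scale c T := mk_adjointable (adj_scaleP c T).
Definition adj_opp := adj_scale (-1).
Definition adj_comp T S := mk_adjointable (adj_compP T S).
Definition theta x y := mk_adjointable (thetaP x y).

HB.instance Definition _ := gen_eqMixin adjointable.
HB.instance Definition _ := gen_choiceMixin adjointable.

Lemma adj_addA : associative adj_add.
Proof. by move=> T S U; apply: adjointable_eq => x /=; rewrite addrA. Qed.

Lemma adj_addC : commutative adj_add.
Proof. by move=> T S; apply: adjointable_eq => x /=; rewrite addrC. Qed.

Lemma adj_add0 : left_id adj_zero adj_add.
Proof. by move=> T; apply: adjointable_eq => x /=; rewrite add0r. Qed.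

Lemma adj_addN : left_inverse adj_zero adj_opp adj_add.
Proof.
by move=> T; apply: adjointable_eq => x /=; rewrite scaleN1r addNr.
Qed.

HB.instance Definition _ := GRing.isZmodule.Build adjointable
  adj_addA adj_addC adj_add0 adj_addN.

Lemma adj_scaleA (b c : R[i]) (T : adjointable) :
  adj_scale b (adj_scale c T) = adj_scale (b * c) T.
Proof. by apply: adjointable_eq => x /=; rewrite scalerA. Qed.

Lemma adj_scale1 : left_id 1 adj_scale.
Proof. by move=> T; apply: adjointable_eq => x /=; rewrite scale1r. Qed.

Lemma adj_scaleDr : right_distributive adj_scale +%R.
Proof. by move=> c T S; apply: adjointable_eq => x /=; rewrite scalerDr. Qed.

Lemma adj_scaleDl (T : adjointable) :
  {morph adj_scale^~ T : b c / b + c}.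
Proof. by move=> b c; apply: adjointable_eq => x /=; rewrite scalerDl. Qed.

HB.instance Definition _ := GRing.Zmodule_isLmodule.Build R[i] adjointable
  adj_scaleA adj_scale1 adj_scaleDr adj_scaleDl.

Lemma adj_compA : associative adj_comp.
Proof. by move=> T S U; exact: adjointable_eq. Qed.

Lemma adj_compDl : left_distributive adj_comp +%R.
Proof. by move=> T S U; exact: adjointable_eq. Qed.

Lemma adjD (T : adjointable) (x y : E) : T (x + y) = T x + T y.
Proof. by have [lT _ _] := adj_funP T; rewrite -(scale1r x) lT !scale1r. Qed.

Lemma adjZ (T : adjointable) (c : R[i]) (x : E) : T (c *: x) = c *: T x.
Proof.
have [lT _ _] := adj_funP T; rewrite -[c *: x]addr0 lT.
suff -> : T 0 = 0 by rewrite addr0.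
by apply: (@addrI _ (T 0)); rewrite -adjD !addr0.
Qed.

Lemma adj_compDr : right_distributive adj_comp +%R.
Proof. by move=> T S U; apply: adjointable_eq => x /=; rewrite adjD. Qed.

Lemma adj_compZl (c : R[i]) (T S : adjointable) :
  adj_comp (c *: T) S = c *: adj_comp T S.
Proof. exact: adjointable_eq. Qed.

Lemma adj_compZr (c : R[i]) (T S : adjointable) :
  adj_comp T (c *: S) = c *: adj_comp T S.
Proof. by apply: adjointable_eq => x /=; rewrite adjZ. Qed.

Lemma adjointK : involutive adjoint.
Proof. by move=> T; apply/adjoint_uniq/is_adjointC/adjointP. Qed.

Lemma adjointD : {morph adjoint : T S / T + S}.
Proof. by move=> T S; exact/adjoint_uniq/adj_addP. Qed.

Lemma adjointZ (c : R[i]) (T : adjointable) :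
  adjoint (c *: T) = c^* *: adjoint T.
Proof. exact/adjoint_uniq/adj_scaleP. Qed.

Lemma adjointM (T S : adjointable) :
  adjoint (adj_comp T S) = adj_comp (adjoint S) (adjoint T).
Proof. exact/adjoint_uniq/adj_compP. Qed.

HB.instance Definition _ := Lmodule_isStarAlgebra.Build R adjointable
  adj_compA adj_compDl adj_compDr adj_compZl adj_compZr
  adjointK adjointD adjointZ adjointM.

(* This is the operator norm of the map induced by [T] on the quotient module
   E_p: the class of [x] has norm [bar_seminorm p x], because the norm of A_p
   is induced by [p]. As no boundedness is built into [adjointable], the value
   is an extended real. *)
Definition op_seminorm (p : A -> R) (T : adjointable) : \bar R :=
  ereal_sup [set (bar_seminorm p (T x))%:E | x in
    [set x | bar_seminorm p x <= 1]].

Definition op_ball (p : A -> R) (S : adjointable) (r : R) : set adjointable :=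
  [set T | (op_seminorm p (T - S)%R < r%:E)%E].

Definition op_balls : set (set adjointable) :=
  [set B | exists p S r, [/\ S_ A p, 0 < r & B = op_ball p S r]].

(* The coarsest topology for which all these balls are open, that is, the one
   defined by the family of seminorms [op_seminorm p]. *)
HB.instance Definition _ := isSubBaseTopological.Build adjointable op_balls id.

End adjointable_operators.

Arguments adjointable {R A} E.

Section compact_operators.
Context (R : realType) (A : locallyCStarType R) (E : hilbertModType A).

Definition finite_rank : set (adjointable E) :=
  [set T | exists (n : nat) (c : 'I_n -> R[i]) (x y : 'I_n -> E),
     T = \sum_(i < n) c i *: theta (x i) (y i)].

Definition compact_operators : set (adjointable E) := closure finite_rank.

End compact_operators.

Arguments compact_operators {R A} E.

(* Main.v *)
(* If K(E) has a countable approximate unit, approximating each of its members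
   by operators of finite rank, for countably many seminorms, only involves
   countably many vectors; they generate E since the unit converges pointwise.

   Conversely, let (g_k) be generators and a_n = n sum_(k < n) theta_(g_k, g_k).
   These operators increase, so e_n = a_n (1 + a_n)^-1 = 1 - (1 + a_n)^-1 does
   too, and (1 + a_n)^-1 tends to 0 on each g_k, hence on E. As a_n may be
   unbounded over the family of all seminorms, 1 + a_n is inverted by solving
   y + a_n y = x in E, with a sequence that converges for each seminorm. The
   square roots required by positivity in K(E) are norm limits of polynomials,
   uniformly in the seminorms.

   Cauchy-Schwarz in E rests on the positivity of c*c in a C*-algebra. It is
   proved here for one C*-seminorm at a time, on the unitization and without
   completion, by working up to an arbitrary error. *)
From HB Require Import structures.
From mathcomp Require Import all_boot all_order all_algebra.
From mathcomp Require Import complex finmap.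
From mathcomp Require Import all_classical all_reals all_analysis.
From mathcomp Require Import ring lra.
From Stdlib Require Ncring Ncring_tac.
Require Import Defs.

Set Implicit Arguments.
Unset Strict Implicit.
Unset Printing Implicit Defensive.

Import Order.TTheory GRing.Theory Num.Theory.
Import numFieldNormedType.Exports.

Local Open Scope classical_set_scope.
Local Open Scope complex_scope.
Local Open Scope ring_scope.
Local Open Scope star_scope.

(** Positivity occurs in two forms. [positive_in] asks for a single factorization [astar c ** c],
    whereas the order arguments below are made for one seminorm at a time, through [posA] and
    quadratic forms. The passage back to a factorization in K(E) happens only in [compact_positive].

    Comparisons of seminorms come with a constant: [p <= C * q] on [A], or a continuous seminorm on
    K(E) against an operator seminorm. The C*-identity removes it, by taking powers 2^k and then
    roots ([pow_le_mul]). This is why the bound 1 holds for every continuous C*-seminorm on K(E),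
    and why an approximation for a cofinal sequence of seminorms on [A] passes to all of them
    without loss.

    The factor n in a_n gives a_n >= n theta_(g_k, g_k) for k < n, so that (1 + a_n)^-1 g_k has norm
    at most n^(-1/2) for every seminorm. *)

Section ncring_instance.
Context (U : pzRingType).
#[global] Instance ring_ncring_ops : @Ncring.Ring_ops U 0 1 +%R *%R (fun x y =>
  x - y) -%R eq := {}.
#[global] Instance ring_ncring : @Ncring.Ring U 0 1 +%R *%R (fun x y => x - y)
  -%R eq ring_ncring_ops.
Proof.
constructor.
- exact: RelationClasses.eq_equivalence.
- by move=> x x' -> y y' ->.
- by move=> x x' -> y y' ->.
- by move=> x x' -> y y' ->.
- by move=> x x' -> .
- exact: add0r.
- exact: addrC.
- exact: addrA.
- exact: mul1r.
- exact: mulr1.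
- exact: mulrA.
- exact: mulrDl.
- move=> x y z; exact: mulrDr.
- by [].
- exact: addrN.
Qed.
End ncring_instance.

Ltac nc_ring := Ncring_tac.non_commutative_ring.

(** * Real inequalities and the modulus of complex numbers *)

Lemma bernoulli_ge (R : realType) (q : R) n : 0 <= q ->
  1 + n%:R * q <= (1 + q) ^+ n.
Proof.
move=> q0; elim: n => [|n IH]; first by rewrite mul0r addr0 expr0.
rewrite exprS; apply: (@le_trans _ _ ((1 + q) * (1 + n%:R * q))).
  have : 0 <= n%:R :> R by [].
  rewrite -natr1; set m : R := n%:R => ?; nra.
by rewrite ler_wpM2l // addr_ge0.
Qed.

(** If x > y > 0, then (x / y)^m grows at least linearly in m and exceeds C. Arbitrarily large
    exponents suffice, so m may run through powers of 2. *)
Lemma pow_le_mul (R : realType) (x y C : R) : 0 <= x -> 0 <= y ->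
  (forall n, exists2 m, (n <= m)%N & x ^+ m <= C * y ^+ m) -> x <= y.
Proof.
move=> x0 y0 H; rewrite leNgt; apply/negP => yx.
have xp : 0 < x by apply: le_lt_trans yx.
have [yz|yn] := eqVneq y 0.
  have [m m1] := H 1%N; rewrite yz expr0n eqn0Ngt m1 mulr0 leNgt.
  by rewrite exprn_gt0.
have yp : 0 < y by rewrite lt0r yn y0.
pose q := x / y - 1; have q0 : 0 < q by rewrite subr_gt0 ltr_pdivlMr // mul1r.
have [m lm hm] := H (Num.truncn (C / q)).+1.
have : 1 + m%:R * q <= C.
  apply: le_trans (bernoulli_ge _ (ltW q0)) _.
  by rewrite /q addrC subrK expr_div_n ler_pdivrMr // exprn_gt0.
have : C / q < m%:R by apply: lt_le_trans (truncnS_gt _) _; rewrite ler_nat.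
by rewrite ltr_pdivrMr //; lra.
Qed.

Lemma conj_realC (R : realType) (t : R) : (t%:C)^* = t%:C.
Proof. by rewrite conj_Creal //; apply/complex_realP; exists t. Qed.

Lemma normc_realC (R : realType) (t : R) : Normc.normc t%:C = `|t|.
Proof. by rewrite /= expr0n addr0 sqrtr_sqr. Qed.

Lemma normc_ge0 (R : realType) (c : R[i]) : 0 <= Normc.normc c.
Proof. by case: c => a b; exact: sqrtr_ge0. Qed.

(** * The square-root iteration and its scalar majorant *)

Section sqrt_majorant.
Context (R : realType).

Fixpoint maj n : R := if n is m.+1 then (1 + maj m ^+ 2) / 2 else 0.

Lemma majS n : maj n.+1 = (1 + maj n ^+ 2) / 2.
Proof. by []. Qed.

Lemma maj_ge0 n : 0 <= maj n.
Proof. by case: n => //= n; rewrite divr_ge0 ?addr_ge0 ?sqr_ge0. Qed.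

Lemma maj_step n : maj n.+1 - maj n = (1 - maj n) ^+ 2 / 2.
Proof. by rewrite /=; field. Qed.

Lemma maj_le1 n : maj n <= 1.
Proof.
elim: n => [|n IH] /=; first exact: ler01.
rewrite ler_pdivrMr // mul1r; have := maj_ge0 n; move: IH.
by set d := maj n => ? ?; nra.
Qed.

(** The gap d = 1 - maj n satisfies d' = d - d^2 / 2, which decays like 2 / n and not geometrically,
    as 1 is a double fixed point. The map d - d^2 / 2 increases on [0, 1], so the inductive bound
    may be inserted in it. *)
Lemma maj_cvg n : 1 - maj n <= 2 / n.+2%:R.
Proof.
elim: n => [|n IH]; first by rewrite /= subr0 divff.
have h1 := maj_step n; have h2 := maj_le1 n.
set d := 1 - maj n in IH h1; have -> : 1 - maj n.+1 = d - d ^+ 2 / 2.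
  by rewrite -h1 /d; ring.
have d0 : 0 <= d by rewrite /d subr_ge0.
have dl : d <= 1 by rewrite /d; have := maj_ge0 n; lra.
set m : R := n.+2%:R in IH; have m2 : 2 <= m by rewrite ler_nat.
have -> : n.+3%:R = m + 1 :> R by rewrite -natr1.
have q1 : 2 / m <= 1 by rewrite ler_pdivrMr; lra.
apply: (@le_trans _ _ (2 / m - (2 / m) ^+ 2 / 2)).
  by set q := 2 / m in IH q1 *; nra.
rewrite ler_pdivlMr; last lra.
have -> : (2 / m - (2 / m) ^+ 2 / 2) * (m + 1) = 2 - 2 / m ^+ 2.
  by field; lra.
by rewrite lerBlDr lerDl divr_ge0 ?sqr_ge0.
Qed.

Lemma exists_inv_lt (e : R) : 0 < e -> exists n : nat, n.+1%:R^-1 < e.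
Proof.
move=> e0; exists (Num.truncn e^-1);
  rewrite -[ltRHS]invrK ltf_pV2 ?posrE ?invr_gt0 //.
by rewrite truncnS_gt.
Qed.

Lemma maj_step_small (e : R) : 0 < e ->
  exists n0, forall n, (n0 <= n)%N -> maj n.+1 - maj n <= e /\ 1 - maj n <= e.
Proof.
move=> e0; have e20 : 0 < e / 2 by rewrite divr_gt0.
have [n0 ln0] := exists_inv_lt e20.
exists n0 => n ln; rewrite maj_step.
have h : 1 - maj n <= e.
  apply: le_trans (maj_cvg n) _; rewrite mulrC -ler_pdivlMr // ltW //.
  apply: le_lt_trans ln0; rewrite lef_pV2 ?posrE // ler_nat.
  by rewrite ltnS ltnW.
split => //.
have := maj_ge0 n; have := maj_le1 n; move: h.
by set d := maj n => ? ? ?; nra.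
Qed.

End sqrt_majorant.

(* For [B u c] meaning "the norm of [u] is at most [c]", the iteration
   [y' = (x + y * y) / 2] towards [1 - sqrt (1 - x)] is majorized by the same
   iteration on scalars, started from the bound [1] of [x]. *)
Section sqrt_iteration.
Context (R : realType) (V : lmodType R[i]) (mul : V -> V -> V).
Hypotheses (mulA : associative mul) (mulDl : left_distributive mul +%R)
  (mulDr : right_distributive mul +%R)
  (mulZl : forall (k : R[i]) u v, mul (k *: u) v = k *: mul u v)
  (mulZr : forall (k : R[i]) u v, mul u (k *: v) = k *: mul u v).
Variable x : V.

(** The product is a parameter because the iteration runs both in a unital algebra, with its ring
    product, and among adjointable operators, with [**]. *)
Fixpoint sqrt_iter n :=
  if n is m.+1 then (2^-1)%:C *: (x + mul (sqrt_iter m) (sqrt_iter m)) else 0.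

Lemma sqrt_iter_comm z n : mul z x = mul x z ->
  mul z (sqrt_iter n) = mul (sqrt_iter n) z.
Proof.
move=> zx; elim: n => [|n IH] /=.
  by rewrite -(scale0r (0 : V)) mulZl mulZr !scale0r.
rewrite mulZr mulZl mulDr mulDl zx; congr (_ *: (_ + _)).
by rewrite mulA IH -mulA IH mulA.
Qed.

Lemma sqrt_iter_swap m n :
  mul (sqrt_iter m) (sqrt_iter n) = mul (sqrt_iter n) (sqrt_iter m).
Proof. by apply: sqrt_iter_comm; exact/esym/sqrt_iter_comm. Qed.

Variable B : V -> R -> Prop.
Hypotheses (B0 : B 0 0)
  (BD : forall u v c d, B u c -> B v d -> B (u + v) (c + d))
  (BZ : forall t u c, 0 <= t -> B u c -> B (t%:C *: u) (t * c))
  (BM : forall u v c d, 0 <= c -> B u c -> B v d -> B (mul u v) (c * d)).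
Hypothesis Bx : B x 1.

Let half_ge0 : 0 <= 2^-1 :> R. Proof. by rewrite invr_ge0. Qed.

Lemma sqrt_iter_bound n : B (sqrt_iter n) (maj R n).
Proof.
elim: n => [|n IH] //=; rewrite mulrC; apply: BZ => //; apply: BD => //.
by rewrite expr2; apply: BM => //; exact: maj_ge0.
Qed.

Lemma sqrt_iter_step n :
  B (sqrt_iter n.+1 - sqrt_iter n) (maj R n.+1 - maj R n).
Proof.
elim: n => [|n IH].
  by rewrite [sqrt_iter 0]/= [maj R 0]/= !subr0; exact: (sqrt_iter_bound 1).
have mulN u v : mul u (- v) = - mul u v by rewrite -scaleN1r mulZr scaleN1r.
(* The iterates commute, so the difference of two squares factors. *)
have -> : sqrt_iter n.+2 - sqrt_iter n.+1 = (2^-1)%:C *: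
    mul (sqrt_iter n.+1 + sqrt_iter n) (sqrt_iter n.+1 - sqrt_iter n).
  rewrite [sqrt_iter n.+2]/= [in X in _ - X]/= -scalerBr; congr (_ *: _).
  rewrite opprD addrACA subrr add0r mulDl !mulDr !mulN (sqrt_iter_swap n n.+1).
  by rewrite addrA subrK.
have -> : maj R n.+2 - maj R n.+1 =
    2^-1 * ((maj R n.+1 + maj R n) * (maj R n.+1 - maj R n)).
  by rewrite (majS R n.+1) [X in _ - X = _]majS; field.
apply: BZ => //; apply: BM => //; first by rewrite addr_ge0 ?maj_ge0.
by apply: BD; exact: sqrt_iter_bound.
Qed.

Lemma sqrt_iter_sub m n : (n <= m)%N ->
  B (sqrt_iter m - sqrt_iter n) (maj R m - maj R n).
Proof.
move=> nm; rewrite -(subnKC nm); elim: (m - n)%N => [|k IH].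
  by rewrite addn0 !subrr.
have E (W : zmodType) (u v w : W) : u - w = (u - v) + (v - w).
  by rewrite addrA subrK.
rewrite addnS (E _ _ (sqrt_iter (n + k))) (E _ _ (maj R (n + k))).
by apply: BD => //; exact: sqrt_iter_step.
Qed.

End sqrt_iteration.

(** * Positivity for a C*-seminorm *)

(** Homogeneity and the C*-identity are asked only as the inequalities that are direct to check for
    a supremum; the equalities follow. [N] may vanish on non-zero elements, so seminorms are covered
    without passing to a quotient. *)
Record cstar_norm (R : realType) (U : algType R[i]) (star : U -> U)
    (N : U -> R) : Prop := CstarNorm {
  cn_starK : involutive star ;
  cn_starD : {morph star : x y / x + y} ;
  cn_starZ : forall (c : R[i]) x, star (c *: x) = c^* *: star x ;
  cn_starM : forall x y, star (x * y) = star y * star x ;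
  cn_ge0 : forall x, 0 <= N x ;
  cn_D : forall x y, N (x + y) <= N x + N y ;
  cn_Z : forall (c : R[i]) x, N (c *: x) <= Normc.normc c * N x ;
  cn_M : forall x y, N (x * y) <= N x * N y ;
  cn_star : forall x, N x ^+ 2 <= N (star x * x)
}.

Section cstar_norm_theory.
Context (R : realType) (U : algType R[i]) (star : U -> U) (N : U -> R).
Hypothesis hN : cstar_norm star N.
Let starK := cn_starK hN.
Let starD := cn_starD hN.
Let starZ := cn_starZ hN.
Let starM := cn_starM hN.
Let N_ge0 := cn_ge0 hN.
Let ND := cn_D hN.
Let NZ := cn_Z hN.
Let NM := cn_M hN.
Let Nstar := cn_star hN.

Implicit Types (x y z a b c : U) (t e : R).

Lemma star_realZ t x : star (t%:C *: x) = t%:C *: star x.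
Proof. by rewrite starZ conj_realC. Qed.

Lemma star0 : star 0 = 0.
Proof. by rewrite -(scale0r (0 : U)) starZ rmorph0 !scale0r. Qed.

Lemma starN x : star (- x) = - star x.
Proof. by apply/eqP; rewrite -addr_eq0 -starD addNr star0. Qed.

Lemma starB x y : star (x - y) = star x - star y.
Proof. by rewrite starD starN. Qed.

Lemma star1 : star 1 = 1.
Proof. by have := starM 1 (star 1); rewrite !mul1r !starK mul1r. Qed.

Lemma starX x n : star (x ^+ n) = star x ^+ n.
Proof.
elim: n => [|n IH]; first by rewrite !expr0 star1.
by rewrite exprS starM IH -exprSr.
Qed.

Lemma cnorm0 : N 0 = 0.
Proof.
apply/eqP; rewrite eq_le N_ge0 andbT -(scale0r (0 : U)).
by apply: le_trans (NZ _ _) _; rewrite Normc.normc0 mul0r.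
Qed.

Lemma cnormN x : N (- x) = N x.
Proof.
suff h y : N (- y) <= N y by apply/eqP; rewrite eq_le h -{1}[x]opprK h.
rewrite -scaleN1r; apply: le_trans (NZ _ _) _.
by rewrite normcN Normc.normc1 mul1r.
Qed.

Lemma cnormBC x y : N (x - y) = N (y - x).
Proof. by rewrite -cnormN opprB. Qed.

Lemma cnormB x y : N (x - y) <= N x + N y.
Proof. by rewrite -(cnormN y); exact: ND. Qed.

Lemma cnorm_le_sub x y : N x <= N y + N (x - y).
Proof. by rewrite -{1}(subrK y x) addrC; exact: ND. Qed.

Lemma cnorm_realZ t x : N (t%:C *: x) = `|t| * N x.
Proof.
apply/eqP; rewrite eq_le -{1}normc_realC NZ /=.
have [->|t0] := eqVneq t 0; first by rewrite normr0 mul0r N_ge0.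
rewrite -{1}[x]scale1r -(mulVf (_ : t%:C != 0)); last by rewrite fmorph_eq0.
rewrite -scalerA -fmorphV; rewrite -ler_pdivlMl ?normr_gt0 //.
by apply: le_trans (NZ _ _) _; rewrite normc_realC normfV.
Qed.

Lemma cnorm_star x : N (star x) = N x.
Proof.
suff h y : N y <= N (star y) by apply/eqP; rewrite eq_le h andbT;
  have := h (star x); rewrite starK.
have [y0|y0] := eqVneq (N y) 0; first by rewrite y0.
have yp : 0 < N y by rewrite lt0r y0 N_ge0.
by rewrite -(ler_pM2r yp) -expr2; apply: le_trans (Nstar _) (NM _ _).
Qed.

Lemma cnorm_star_mul x : N (star x * x) = N x ^+ 2.
Proof.
apply/eqP; rewrite eq_le Nstar andbT; apply: le_trans (NM _ _) _.
by rewrite cnorm_star expr2.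
Qed.

Lemma cnorm_sa_sqr x : star x = x -> N (x * x) = N x ^+ 2.
Proof. by move=> sx; rewrite -cnorm_star_mul sx. Qed.

Lemma cnorm1_le1 : N 1 <= 1.
Proof.
have := cnorm_star_mul 1; rewrite mulr1 star1; have := N_ge0 1.
by set n := N 1; nra.
Qed.

Lemma cnorm_realA t : N (t%:C%:A) <= `|t|.
Proof. by rewrite cnorm_realZ ler_piMr ?normr_ge0 // cnorm1_le1. Qed.

Lemma cnormX x n : N (x ^+ n.+1) <= N x ^+ n.+1.
Proof.
elim: n => // n IH; rewrite exprS [_ ^+ n.+2]exprS.
by apply: le_trans (NM _ _) _; rewrite ler_wpM2l.
Qed.

Lemma cnorm_sa_exp2 x k : star x = x -> N (x ^+ (2 ^ k)) = N x ^+ (2 ^ k).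
Proof.
move=> sx; elim: k => [|k IH]; first by rewrite expn0.
by rewrite expnS mulnC exprM expr2 cnorm_sa_sqr ?starX ?sx // IH exprM.
Qed.

(** The C*-identity gives equality at the exponents 2 ^ k. For a smaller exponent, split off the
    remaining power, use submultiplicativity and cancel. *)
Lemma cnorm_sa_exp x n : star x = x -> N x ^+ n.+1 <= N (x ^+ n.+1).
Proof.
move=> sx; have [x0|x0] := eqVneq (N x) 0.
  by rewrite x0 expr0n /= N_ge0.
have xp : 0 < N x by rewrite lt0r x0 N_ge0.
have ltn : (n.+1 < 2 ^ n.+1)%N by exact: ltn_expl.
have [k kE] : exists k, (2 ^ n.+1 = n.+1 + k.+1)%N.
  by exists (2 ^ n.+1 - n.+2)%N; rewrite addnS -addSn subnKC.
have := cnorm_sa_exp2 n.+1 sx; rewrite kE exprD => h.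
have : N x ^+ n.+1 * N x ^+ k.+1 <= N (x ^+ n.+1) * N x ^+ k.+1.
  rewrite -exprD -h; apply: le_trans (NM _ _) _.
  by rewrite ler_wpM2l // cnormX.
by rewrite ler_pM2r // exprn_gt0.
Qed.

(** Only an approximate root of 1 - x is available, as [U] need not be complete. The commutation
    clause stands for s being a polynomial in x. *)
Lemma sqrt_approx x e : 0 < e -> star x = x -> N x <= 1 -> exists s,
  [/\ star s = s, N (s * s - (1 - x)) <= e
    & forall z, z * x = x * z -> z * s = s * z].
Proof.
move=> e0 sx x1.
pose y := sqrt_iter *%R x.
have mZl (k : R[i]) (u v : U) : k *: u * v = k *: (u * v) by rewrite scalerAl.
have mZr (k : R[i]) (u v : U) : u * (k *: v) = k *: (u * v) by rewrite scalerAr.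
have cy z n : z * x = x * z -> z * y n = y n * z.
  exact: (sqrt_iter_comm (@mulrA U) (@mulrDl U) (@mulrDr U) mZl mZr).
have sy n : star (y n) = y n.
  elim: n => [|n IH]; first exact: star0.
  by rewrite /y /= star_realZ starD starM sx -/(y n) IH.
have Nyd n : N (y n.+1 - y n) <= maj R n.+1 - maj R n.
  refine (sqrt_iter_step (@mulrA U) (@mulrDl U) (@mulrDr U) mZl mZr
    (B := fun u t => N u <= t) _ _ _ _ _ n) => //.
  - by rewrite cnorm0.
  - by move=> u v s t us vt; apply: le_trans (ND _ _) (lerD _ _).
  - by move=> t u s t0 us; rewrite cnorm_realZ ger0_norm // ler_wpM2l.
  - by move=> u v s t s0 us vt; apply: le_trans (NM _ _) _; exact: ler_pM.
have [n0 /(_ n0 (leqnn _)) [hn _]] := maj_step_small (divr_gt0 e0 (ltr0n _ 2)).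
exists (1 - y n0); split.
- by rewrite starB star1 sy.
(* With y' = (x + y y) / 2, the defect of the root is x + y y - 2 y = 2 (y' - y). *)
- have -> : (1 - y n0) * (1 - y n0) - (1 - x) = 2%:C *: (y n0.+1 - y n0).
    rewrite scalerBr {1}/y /= scalerA -rmorphM /= divff // scale1r -/(y n0).
    rewrite rmorphD rmorph1 scalerDl scale1r; nc_ring.
  rewrite cnorm_realZ ger0_norm //; have := Nyd n0; lra.
- by move=> z zx; rewrite mulrBr mulrBl mulr1 mul1r cy.
Qed.

Local Notation "t %:S" := (t%:C%:A : U) (at level 2, format "t %:S").

(* [a + i b] is unitary up to [e]. *)
Lemma cnorm_sa_unitary_part a b e : star a = a -> star b = b -> a * b = b * a ->
  N (a * a + b * b - 1) <= e -> N a ^+ 2 <= 1 + e.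
Proof.
move=> sa sb ab He; pose c := 'i *: b; pose u := a + c.
have sc : star c = - c by rewrite starZ sb conjCi scaleNr.
have su : star u = a - c by rewrite starD sa sc.
have cc : c * c = - (b * b).
  by rewrite /c -scalerAl -scalerAr scalerA -expr2 sqrCi scaleN1r.
have ac : a * c = c * a by rewrite /c -scalerAl -scalerAr ab.
have uu : star u * u = 1 + (a * a + b * b - 1).
  rewrite su /u mulrBl !mulrDr cc ac; nc_ring.
have Nu : N u ^+ 2 <= 1 + e.
  rewrite -cnorm_star_mul uu; apply: le_trans (ND _ _) _.
  by rewrite lerD // cnorm1_le1.
apply: le_trans Nu; rewrite ler_sqr ?nnegrE //.
have -> : a = (2^-1)%:C *: (u + star u).
  have -> : u + star u = 2%:C *: a.
    by rewrite su rmorphD rmorph1 scalerDl scale1r /u; nc_ring.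
  by rewrite scalerA -rmorphM /= mulVf // scale1r.
rewrite cnorm_realZ ger0_norm ?invr_ge0 // mulrC ler_pdivrMr //.
by apply: le_trans (ND _ _) _; rewrite cnorm_star; lra.
Qed.

(* Positivity through the norm alone, so that neither a spectrum nor the
   completeness of [U] is involved. *)
Definition pos a := star a = a /\ exists t, N (t%:S - a) <= t.

Lemma realAB t s : (t - s)%:S = t%:S - s%:S.
Proof. by rewrite rmorphB scalerBl. Qed.

Lemma realAD t s : (t + s)%:S = t%:S + s%:S.
Proof. by rewrite rmorphD scalerDl. Qed.

Lemma star_realA t : star t%:S = t%:S.
Proof. by rewrite star_realZ star1. Qed.

(** For s close to a square root of 1 - b^2, the element s + i b is nearly unitary. Hence the norm
    of s is nearly at most 1, and 1 - b^2 is close to s^2. *)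
Lemma cnorm_1_sub_sqr b : star b = b -> N b <= 1 -> N (1 - b * b) <= 1.
Proof.
move=> sb b1; apply/ler_addgt0Pr => e e0.
have e20 : 0 < e / 2 by rewrite divr_gt0.
have sbb : star (b * b) = b * b by rewrite starM sb.
have bb1 : N (b * b) <= 1 by rewrite cnorm_sa_sqr // expr_le1.
have [s [ss sE sC]] := sqrt_approx e20 sbb bb1.
have bs : s * b = b * s by apply/esym/sC; rewrite mulrA.
have h : N (s * s + b * b - 1) <= e / 2.
  by move: sE; congr (N _ <= _); nc_ring.
have := cnorm_sa_unitary_part ss sb bs h; rewrite -cnorm_sa_sqr // => h'.
rewrite cnormBC in sE.
by apply: le_trans (cnorm_le_sub _ (s * s)) _; lra.
Qed.

Lemma cnorm_sub_sqr b t : star b = b -> N b ^+ 2 <= t -> N (t%:S - b * b) <= t.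
Proof.
move=> sb bt; have t0 : 0 <= t by apply: le_trans bt; rewrite sqr_ge0.
have [t00|t0'] := eqVneq t 0.
  rewrite t00 in bt *; rewrite rmorph0 scale0r sub0r cnormN.
  by apply: le_trans bt; rewrite cnorm_sa_sqr.
have tp : 0 < t by rewrite lt0r t0' t0.
pose r := Num.sqrt t; have r0 : 0 < r by rewrite sqrtr_gt0.
have rr : r * r = t by rewrite -expr2 sqr_sqrtr.
pose b' := (r^-1)%:C *: b.
have sb' : star b' = b' by rewrite star_realZ sb.
have Nb' : N b' <= 1.
  rewrite cnorm_realZ gtr0_norm ?invr_gt0 // ler_pdivrMl // mulr1.
  by rewrite -ler_sqr ?nnegrE ?(ltW r0) // sqr_sqrtr.
have -> : t%:S - b * b = t%:C *: (1 - b' * b').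
  rewrite scalerBr; congr (_ - _).
  rewrite /b' -scalerAl -scalerAr !scalerA -!rmorphM /= -rr.
  by rewrite (_ : r * r * _ * _ = 1) ?scale1r //; field; rewrite gt_eqF.
by rewrite cnorm_realZ gtr0_norm // ler_piMr // cnorm_1_sub_sqr.
Qed.

Lemma pos_star a : pos a -> star a = a. Proof. by case. Qed.

Lemma pos_ge0 a t : N (t%:S - a) <= t -> 0 <= t.
Proof. exact: le_trans. Qed.

(** [pos] says that 1 - a / t is a contraction, which is the input of [sqrt_approx]; t = 0 forces N
    a = 0. *)
Lemma pos_sqrt_approx a e : pos a -> 0 < e -> exists s,
  [/\ star s = s, N (s * s - a) <= e & forall z, z * a = a * z ->
    z * s = s * z].
Proof.
move=> [sa [t Ht]] e0; have t0 := pos_ge0 Ht.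
have [t00|t0'] := eqVneq t 0.
  exists 0; split; rewrite ?star0 // ?mulr0 ?sub0r ?cnormN; last by move=> z;
    rewrite mulr0 mul0r.
  by move: Ht; rewrite t00 rmorph0 scale0r sub0r cnormN => /le_trans; apply;
    exact: ltW.
have tp : 0 < t by rewrite lt0r t0' t0.
pose r := Num.sqrt t; have r0 : 0 < r by rewrite sqrtr_gt0.
have rr : r * r = t by rewrite -expr2 sqr_sqrtr.
pose x := 1 - (t^-1)%:C *: a.
have sx : star x = x by rewrite starB star1 star_realZ sa.
have tx : t%:C *: x = t%:S - a.
  by rewrite scalerBr scalerA -rmorphM /= divff // scale1r.
have Nx : N x <= 1.
  by rewrite -(ler_pM2l tp) mulr1 -{1}(gtr0_norm tp) -cnorm_realZ tx.
have et : 0 < e / t by rewrite divr_gt0.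
have [s [ss sE sC]] := sqrt_approx et sx Nx.
exists (r%:C *: s); split; first by rewrite star_realZ ss.
- have -> : r%:C *: s * (r%:C *: s) - a = t%:C *: (s * s - (1 - x)).
    rewrite -scalerAl -scalerAr scalerA -rmorphM /= rr.
    rewrite [RHS]scalerBr; congr (_ - _).
    by rewrite scalerBr tx; nc_ring.
  by rewrite cnorm_realZ gtr0_norm // mulrC -ler_pdivlMr.
- move=> z za; rewrite -scalerAl -scalerAr sC //.
  by rewrite /x mulrBr mulrBl mul1r mulr1 -scalerAl -scalerAr za.
Qed.

(** The radius hidden in [pos] can be replaced by any bound of the norm, because a is nearly the
    square of a self-adjoint element, for which [cnorm_sub_sqr] holds. *)
Lemma pos_cnorm_sub a t : pos a -> N a <= t -> N (t%:S - a) <= t.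
Proof.
move=> pa at_; apply/ler_addgt0Pr => e e0.
have e30 : 0 < e / 3 by rewrite divr_gt0.
have [s [ss sE _]] := pos_sqrt_approx pa e30.
have h : N s ^+ 2 <= t + e / 3.
  by rewrite -cnorm_sa_sqr //; apply: le_trans (cnorm_le_sub _ a) _;
    rewrite lerD.
have := cnorm_sub_sqr ss h; rewrite realAD => h2.
have -> : t%:S - a = (t%:S + (e / 3)%:S - s * s) + ((s * s - a) - (e / 3)%:S).
  nc_ring.
apply: le_trans (ND _ _) _.
have : N ((s * s - a) - (e / 3)%:S) <= e / 3 + e / 3.
  apply: le_trans (cnormB _ _) (lerD sE _); apply: le_trans (cnorm_realA _) _.
  by rewrite gtr0_norm.
lra.
Qed.

Lemma pos_sqr b : star b = b -> pos (b * b).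
Proof.
by move=> sb; split; [rewrite starM sb|exists (N b ^+ 2); exact: cnorm_sub_sqr].
Qed.

Lemma pos_add a b : pos a -> pos b -> pos (a + b).
Proof.
move=> [sa [t Ht]] [sb [s Hs]]; split; first by rewrite starD sa sb.
exists (t + s); have -> : (t + s)%:S - (a + b) = (t%:S - a) + (s%:S - b).
  by rewrite realAD; nc_ring.
by apply: le_trans (ND _ _) _; rewrite lerD.
Qed.

Lemma posZ t a : 0 <= t -> pos a -> pos (t%:C *: a).
Proof.
move=> t0 [sa [s Hs]]; split; first by rewrite star_realZ sa.
exists (t * s); have -> : (t * s)%:S - t%:C *: a = t%:C *: (s%:S - a).
  by rewrite scalerBr scalerA rmorphM.
by rewrite cnorm_realZ ger0_norm // ler_wpM2l.
Qed.

Lemma pos_real t : 0 <= t -> pos t%:S.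
Proof.
by move=> t0; split; [exact: star_realA|exists t; rewrite subrr cnorm0].
Qed.

(** By [pos_cnorm_sub], the one radius N a + 1 serves all positive b within distance 1 of a, so it
    survives the limit. *)
Lemma pos_closed a : star a = a ->
  (forall e, 0 < e -> exists2 b, pos b & N (b - a) <= e) -> pos a.
Proof.
move=> sa H; split => //; exists (N a + 1); apply/ler_addgt0Pr => e e0.
pose d := Num.min e 1; have d0 : 0 < d by rewrite lt_min e0 ltr01.
have de : d <= e by rewrite ge_min lexx.
have d1 : d <= 1 by rewrite ge_min lexx orbT.
have [b pb Nb] := H _ d0.
have Nb1 : N b <= N a + 1.
  by apply: le_trans (cnorm_le_sub _ a) _; rewrite lerD // (le_trans Nb).
have := pos_cnorm_sub pb Nb1 => h.
have -> : (N a + 1)%:S - a = ((N a + 1)%:S - b) + (b - a) by nc_ring.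
by apply: le_trans (ND _ _) _; lra.
Qed.

Lemma pos_real_sub a t : star a = a -> N a <= t -> pos (t%:S - a).
Proof.
move=> sa at_; split; first by rewrite starB star_realA sa.
by exists t; rewrite opprB addrC subrK.
Qed.

Lemma pos_real_subW a t s : pos (t%:S - a) -> t <= s -> pos (s%:S - a).
Proof.
move=> pa ts; have -> : s%:S - a = (t%:S - a) + (s - t)%:S.
  by rewrite realAB; nc_ring.
by apply: pos_add => //; apply: pos_real; rewrite subr_ge0.
Qed.

(** Approximate roots b of a and c of 1 - a commute, and b + i c is nearly unitary; so b, hence a,
    has norm nearly at most 1. *)
Lemma pos_sub1_cnorm a : pos a -> pos (1 - a) -> N a <= 1.
Proof.
move=> pa pa'; apply/ler_addgt0Pr => e e0.
have e30 : 0 < e / 3 by rewrite divr_gt0.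
have [b [sb bE bC]] := pos_sqrt_approx pa e30.
have [c [sc cE cC]] := pos_sqrt_approx pa' e30.
have bc : b * c = c * b.
  by apply: cC; rewrite mulrBr mulrBl mulr1 mul1r (bC a).
have h : N (b * b + c * c - 1) <= e / 3 + e / 3.
  have -> : b * b + c * c - 1 = (b * b - a) + (c * c - (1 - a)) by nc_ring.
  by apply: le_trans (ND _ _) (lerD _ _).
have := cnorm_sa_unitary_part sb sc bc h; rewrite -cnorm_sa_sqr // => h'.
rewrite cnormBC in bE.
by apply: le_trans (cnorm_le_sub _ (b * b)) _; lra.
Qed.

Lemma pos_sub_cnorm a t : 0 <= t -> pos a -> pos (t%:S - a) -> N a <= t.
Proof.
move=> t0 pa pt; apply/ler_addgt0Pr => e e0.
have s0 : 0 < t + e by rewrite ltr_wpDl.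
have ps : pos ((t + e)%:S - a) by apply: pos_real_subW pt _; rewrite lerDl ltW.
have p1 : pos ((t + e)^-1%:C *: a) by apply: posZ => //; rewrite invr_ge0 ltW.
have p2 : pos (1 - (t + e)^-1%:C *: a).
  have -> : 1 - (t + e)^-1%:C *: a = (t + e)^-1%:C *: ((t + e)%:S - a).
    by rewrite scalerBr scalerA -rmorphM /= mulVf ?gt_eqF // scale1r.
  by apply: posZ => //; rewrite invr_ge0 ltW.
have := pos_sub1_cnorm p1 p2.
by rewrite cnorm_realZ gtr0_norm ?invr_gt0 // ler_pdivrMl // mulr1.
Qed.

Lemma pos_le_cnorm a b : pos a -> pos (b - a) -> N a <= N b.
Proof.
move=> pa pba; apply: pos_sub_cnorm => //.
have -> : (N b)%:S - a = ((N b)%:S - b) + (b - a) by nc_ring.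
apply: pos_add => //; apply: pos_real_sub => //.
by rewrite -[b](subrK a) starD (pos_star pba) (pos_star pa).
Qed.

(** Commutation makes z b self-adjoint for an approximate root b of a, so only squares of
    self-adjoint elements occur. The general [pos_conj] has to wait for [pos_star_mul]. *)
Lemma pos_conj_comm a z : pos a -> star z = z -> z * a = a * z ->
  pos (z * a * z).
Proof.
move=> pa sz za; apply: pos_closed;
  first by rewrite !starM sz (pos_star pa) mulrA.
move=> e e0; have k0 : 0 < N z ^+ 2 + 1 by rewrite ltr_wpDl ?sqr_ge0.
have [b [sb bE bC]] := pos_sqrt_approx pa (divr_gt0 e0 k0).
have zb := bC _ za; exists ((z * b) * (z * b)).
  by apply: pos_sqr; rewrite starM sz sb zb.
have -> : z * b * (z * b) - z * a * z = z * (b * b - a) * z.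
  by rewrite mulrBr mulrBl {2}zb !mulrA.
apply: le_trans (NM _ _) _; apply: (@le_trans _ _ (N z ^+ 2 * (e / (N z ^+ 2 +
  1)))).
  rewrite expr2 mulrAC ler_wpM2r //; apply: le_trans (NM _ _) _.
  by rewrite ler_wpM2l.
by rewrite mulrCA ler_piMr ?(ltW e0) // ler_pdivrMr // mul1r lerDl.
Qed.

(* Nonzero spectral values of [c*c] and [cc*] agree; the factor [c] is moved
   across a high power of [1 - cc*]. *)
Lemma cnorm_1_sub_star_mul_sym c t : 1 <= t -> N (1 - c * star c) <= t ->
  N (1 - star c * c) <= t.
Proof.
move=> t1; set v := 1 - c * star c; set w := 1 - star c * c => vt.
have sw : star w = w by rewrite starB star1 starM starK.
have wc n : w ^+ n * star c = star c * v ^+ n.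
  elim: n => [|n IH]; first by rewrite !expr0 mulr1 mul1r.
  by rewrite [w ^+ _]exprS -mulrA IH [v ^+ n.+1]exprS; rewrite /w /v; nc_ring.
have [r1|r1] := leP (N w) 1; first exact: le_trans r1 t1.
apply: (@pow_le_mul _ _ _ (N (star c) * N c / (N w - 1))) => //.
  by apply: le_trans t1.
move=> n; exists n.+1 => //.
rewrite mulrAC ler_pdivlMr ?subr_gt0 // mulrBr mulr1 lerBlDr -exprSr.
apply: le_trans (cnorm_sa_exp n.+1 sw) _.
have -> : w ^+ n.+2 = - (star c * v ^+ n.+1 * c) + w ^+ n.+1.
  rewrite -wc [w ^+ n.+2]exprSr {2}/w; nc_ring.
apply: le_trans (ND _ _) _; rewrite cnormN; apply: lerD; last exact: cnormX.
apply: le_trans (NM _ _) _; rewrite [leRHS]mulrAC ler_wpM2r //.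
apply: le_trans (NM _ _) _; rewrite ler_wpM2l //.
by apply: le_trans (cnormX _ _) _; rewrite lerXn2r ?nnegrE // (le_trans _ t1).
Qed.

Lemma pos_real_add_sym d e : 0 <= e -> pos (e%:S + d * star d) ->
  pos (e%:S + star d * d).
Proof.
move=> e0 pd; split; first by rewrite starD starM starK star_realA.
(* The last summands keep t - e positive. After division by t - e, the bound becomes t / (t - e),
   which is at least 1 as [cnorm_1_sub_star_mul_sym] demands. *)
pose t := N (e%:S + d * star d) + e + 1; exists t.
have te : 0 < t - e by rewrite /t addrAC addrK ltr_wpDl.
have t0 : 0 < t by apply: lt_le_trans te _; rewrite lerBlDr lerDl.
have ht : N (e%:S + d * star d) <= t by rewrite /t -addrA lerDl addr_ge0.
have := pos_cnorm_sub pd ht.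
pose r := Num.sqrt (t - e); have r0 : 0 < r by rewrite sqrtr_gt0.
have rr : r * r = t - e by rewrite -expr2 sqr_sqrtr // ltW.
pose c := (r^-1)%:C *: d.
have E x y : t%:S - (e%:S + x * y) =
    (t - e)%:C *: (1 - (r^-1)%:C *: x * ((r^-1)%:C *: y)).
  rewrite -scalerAl -scalerAr scalerA -rmorphM /= scalerBr scalerA -rmorphM /=.
  rewrite -{2}rr (_ : r * r * _ = 1); last by field; rewrite gt_eqF.
  by rewrite scale1r realAB; nc_ring.
rewrite !E !cnorm_realZ gtr0_norm // mulrC -ler_pdivlMr // -(star_realZ _ d) =>
  h.
rewrite mulrC -ler_pdivlMr //; apply: cnorm_1_sub_star_mul_sym h.
by rewrite ler_pdivlMr // mul1r lerBlDr lerDl.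
Qed.

Lemma pos_exp w n : pos w -> pos (w ^+ n).
Proof.
move=> pw; have sw := pos_star pw.
rewrite -(odd_double_half n) -addnn; case: (odd n) => /=; last first.
  by rewrite add0n exprD; apply: pos_sqr; rewrite starX sw.
rewrite exprD exprD expr1 mulrA.
have -> : w * w ^+ n./2 = w ^+ n./2 * w by rewrite -exprS exprSr.
by apply: pos_conj_comm; rewrite ?starX ?sw // -exprS exprSr.
Qed.

(** The terms w^k (1 - w) decrease in k and the first m of them sum to 1 - w^m; hence m w^m (1 - w)
    <= 1 - w^m <= 1. *)
Lemma pos_exp_gap w n : pos w -> pos (n.+1%:R^-1%:S - w ^+ n.+1 * (1 - w)).
Proof.
move=> pw; have sw := pos_star pw.
have sw1 : star (1 - w) = 1 - w by rewrite starB star1 sw.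
have gap k : pos (w ^+ k * (1 - w) - w ^+ k.+1 * (1 - w)).
  have -> : w ^+ k * (1 - w) - w ^+ k.+1 * (1 - w) = (1 - w) * w ^+ k * (1 - w).
    by rewrite [w ^+ k.+1]exprS; nc_ring.
  apply: pos_conj_comm => //; first exact: pos_exp.
  by rewrite mulrBl mulrBr mulr1 mul1r -exprS exprSr.
have H m : pos (1 - w ^+ m - m%:R%:S * (w ^+ m * (1 - w))).
  elim: m => [|m IH].
    rewrite expr0 rmorph0 scale0r mul0r subrr subr0 -(scale0r (1 : U)).
    by rewrite -(rmorph0 (real_complex R)); exact: pos_real.
  have -> : 1 - w ^+ m.+1 - m.+1%:R%:S * (w ^+ m.+1 * (1 - w)) =
     (1 - w ^+ m - m%:R%:S * (w ^+ m * (1 - w))) +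
     m.+1%:R%:S * (w ^+ m * (1 - w) - w ^+ m.+1 * (1 - w)).
    rewrite -natr1 realAD rmorph1 scale1r [w ^+ m.+1]exprSr; nc_ring.
  by apply: pos_add => //; rewrite mulr_algl; exact: posZ.
have := pos_add (H n.+1) (pos_exp n.+1 pw); rewrite addrAC subrK => h.
have -> : n.+1%:R^-1%:S - w ^+ n.+1 * (1 - w) =
   n.+1%:R^-1%:C *: (1 - n.+1%:R%:S * (w ^+ n.+1 * (1 - w))).
  by rewrite scalerBr mulr_algl scalerA -rmorphM /= mulVf // scale1r.
by apply: posZ.
Qed.

(* Kaplansky's argument that [c*c] is positive. With [w = 1 - c*c] and
   [d = c w^n], the element [d*d = w^(2n) (1 - w)] is at most [1 / (2n)], hence
   [dd*], and by symmetry [d*d], is at least [- 1 / (2n)]. A norm of [w] above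
   [1] would make [d*d] large. *)
Lemma cnorm_1_sub_star_mul c : N c <= 1 -> N (1 - star c * c) <= 1.
Proof.
move=> c1; pose h := star c * c; pose w := 1 - h.
have sh : star h = h by rewrite starM starK.
have sw : star w = w by rewrite starB star1 sh.
have pw : pos w.
  split => //; exists 1; rewrite rmorph1 scale1r opprB addrC subrK.
  by rewrite cnorm_star_mul expr_le1.
have wh n : w ^+ n * h = h * w ^+ n.
  by apply/esym/commrX; rewrite /GRing.comm /w mulrBl mulrBr mulr1 mul1r.
have key n : N w ^+ (n.+1.*2).+1 <= N w ^+ n.+1.*2 + 3 / n.+1.*2%:R.
  pose m := n.+1.*2; pose d := c * w ^+ n.+1.
  pose e : R := m%:R^-1; have e0 : 0 <= e by rewrite invr_ge0.
  have dE : star d * d = w ^+ m * (1 - w).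
    have -> : 1 - w = h by rewrite /w opprB addrC subrK.
    by rewrite /m -addnn exprD -mulrA wh /d starM starX sw /h !mulrA.
  have p1 : pos (e%:S - star d * d) by rewrite dE; exact: pos_exp_gap.
  have p2 : pos (star d * d + d * star d).
    (* Up to sign, these are twice the real and imaginary parts of [d]. *)
    pose x := d + star d; pose y := 'i *: (d - star d).
    have sx : star x = x by rewrite starD starK addrC.
    have sy : star y = y.
      by rewrite starZ starB starK conjCi scaleNr -scalerN opprB.
    have -> : star d * d + d * star d = (2^-1)%:C *: (x * x + y * y).
      have -> : x * x + y * y = 2%:C *: (star d * d + d * star d).
        rewrite /y -scalerAl -scalerAr scalerA -['i * _]expr2 sqrCi scaleN1r.
        by rewrite /x rmorphD rmorph1 scalerDl scale1r; nc_ring.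
      by rewrite scalerA -rmorphM /= mulVf // scale1r.
    by apply: posZ; [rewrite invr_ge0|apply: pos_add; exact: pos_sqr].
  have p3 : pos (e%:S + star d * d).
    apply: pos_real_add_sym => //.
    have -> : e%:S + d * star d = (e%:S - star d * d) + (star d * d + d * star
      d).
      by nc_ring.
    exact: pos_add.
  have : N (e%:S + star d * d) <= e + e.
    apply: pos_sub_cnorm; rewrite ?addr_ge0 //.
    have -> // : (e + e)%:S - (e%:S + star d * d) = e%:S - star d * d.
    by rewrite realAD; nc_ring.
  have Ed : star d * d = (e%:S + star d * d) - e%:S by nc_ring.
  move=> he; have hd : N (star d * d) <= 3 * e.
    rewrite Ed; apply: le_trans (cnormB _ _) _; have := cnorm_realA e.
    by rewrite ger0_norm //; lra.
  apply: le_trans (cnorm_sa_exp m sw) _.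
  have -> : w ^+ m.+1 = w ^+ m - star d * d.
    by rewrite dE exprSr; nc_ring.
  apply: le_trans (cnormB _ _) _; apply: lerD => //.
  by rewrite /m doubleS; exact: cnormX.
rewrite -/h -/w leNgt; apply/negP => w1.
(* If N w > 1, passing from the power m to m + 1 adds at least N w - 1, which exceeds 3 / m for
   large m. *)
have w3 : 0 < (N w - 1) / 3 by rewrite divr_gt0 // subr_gt0.
have [n Hn] := exists_inv_lt w3.
have := key n; apply/negP; rewrite -ltNge.
have : 3 / n.+1.*2%:R < N w - 1.
  rewrite mulrC -ltr_pdivlMr //; apply: le_lt_trans Hn.
  by rewrite lef_pV2 ?posrE // ler_nat -addnn leq_addr.
have : 1 <= N w ^+ n.+1.*2 by rewrite exprn_ege1 // ltW.
rewrite exprS; set q := N w ^+ _; set s := _ / _; nra.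
Qed.

Lemma pos_star_mul c : pos (star c * c).
Proof.
split; first by rewrite starM starK.
have [c0|c0] := eqVneq (N c) 0.
  exists 0; rewrite rmorph0 scale0r sub0r cnormN cnorm_star_mul c0.
  by rewrite expr0n.
have cp : 0 < N c by rewrite lt0r c0 N_ge0.
exists (N c ^+ 2).
pose b := (N c)^-1%:C *: c.
have -> : (N c ^+ 2)%:S - star c * c = (N c ^+ 2)%:C *: (1 - star b * b).
  rewrite scalerBr /b star_realZ -scalerAl -scalerAr !scalerA -!rmorphM /=.
  by rewrite (_ : _ ^+ 2 * _ * _ = 1) ?scale1r //; field.
rewrite cnorm_realZ ger0_norm ?sqr_ge0 // ler_piMr ?sqr_ge0 //.
apply: cnorm_1_sub_star_mul; rewrite cnorm_realZ gtr0_norm ?invr_gt0 // mulVf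
  //.
Qed.

Lemma pos_conj a z : pos a -> pos (star z * a * z).
Proof.
move=> pa; apply: pos_closed; first by rewrite !starM starK (pos_star pa) mulrA.
move=> e e0; have k0 : 0 < N z ^+ 2 + 1 by rewrite ltr_wpDl ?sqr_ge0.
have [b [sb bE _]] := pos_sqrt_approx pa (divr_gt0 e0 k0).
exists (star (b * z) * (b * z)); first exact: pos_star_mul.
have -> : star (b * z) * (b * z) - star z * a * z = star z * (b * b - a) * z.
  by rewrite starM sb; nc_ring.
apply: le_trans (NM _ _) _; apply: (@le_trans _ _ (N z ^+ 2 * (e / (N z ^+ 2 +
  1)))).
  rewrite expr2 mulrAC ler_wpM2r //; apply: le_trans (NM _ _) _.
  by rewrite cnorm_star ler_wpM2l.
by rewrite mulrCA ler_piMr ?(ltW e0) // ler_pdivrMr // mul1r lerDl.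
Qed.
End cstar_norm_theory.

Section star_algebra.
Context (R : realType) (A : starAlgType R).
Implicit Types (a b c : A).

Lemma amul0r a : (0 : A) ** a = 0.
Proof. by apply: (@addrI _ (0 ** a)); rewrite -amulDl !addr0. Qed.

Lemma amulr0 a : a ** (0 : A) = 0.
Proof. by apply: (@addrI _ (a ** 0)); rewrite -amulDr !addr0. Qed.

Lemma amulNr a b : (- a) ** b = - (a ** b).
Proof. by apply/eqP; rewrite -addr_eq0 -amulDl addNr amul0r. Qed.

Lemma amulrN a b : a ** (- b) = - (a ** b).
Proof. by apply/eqP; rewrite -addr_eq0 -amulDr addNr amulr0. Qed.

Lemma amulBl a b c : (a - b) ** c = a ** c - b ** c.
Proof. by rewrite amulDl amulNr. Qed.

Lemma amulBr a b c : a ** (b - c) = a ** b - a ** c.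
Proof. by rewrite amulDr amulrN. Qed.

Lemma astar0 : astar (0 : A) = 0.
Proof. by rewrite -(scale0r (0 : A)) astarZ rmorph0 !scale0r. Qed.

Lemma astarN a : astar (- a) = - astar a.
Proof. by apply/eqP; rewrite -addr_eq0 -astarD addNr astar0. Qed.

Lemma astarB a b : astar (a - b) = astar a - astar b.
Proof. by rewrite astarD astarN. Qed.

End star_algebra.

(** * The unitization *)

Definition unitization (R : realType) (A : starAlgType R) : Type :=
  (R[i]^o * A)%type.

Section unitization_algebra.
Context (R : realType) (A : starAlgType R).

HB.instance Definition _ := GRing.Lmodule.copy (unitization A) (R[i]^o *
  A)%type.

Implicit Types x y z : unitization A.

Definition unitization_one : unitization A := (1, 0).
Definition unitization_mul x y : unitization A :=
  (x.1 * y.1, x.1 *: y.2 + y.1 *: x.2 + x.2 ** y.2).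
Definition unitization_star x : unitization A := (x.1^*, astar x.2).

Let mulA : associative unitization_mul.
Proof.
move=> [l a] [m b] [n c]; congr pair => /=; first by rewrite mulrA.
rewrite !amulDr !amulDl !scalerDr !amulZl !amulZr !scalerA amulA.
rewrite (mulrC n l) (mulrC n m) !addrA.
by rewrite [LHS](ACl (1*2*4*6*3*5*7)%AC).

Qed.

Let mul1 : left_id unitization_one unitization_mul.
Proof.
by move=> [l a]; congr pair => /=;
  rewrite ?mul1r // scale1r scaler0 amul0r !addr0.
Qed.

Let mulr1 : right_id unitization_one unitization_mul.
Proof.
by move=> [l a]; congr pair => /=;
  rewrite ?mulr1 // scale1r scaler0 amulr0 add0r addr0.
Qed.

Let mulDl : left_distributive unitization_mul +%R.
Proof.
move=> [l a] [m b] [n c]; congr pair => /=; first by rewrite mulrDl.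
by rewrite amulDl !scalerDl !scalerDr !addrA [LHS](ACl (1*3*5*2*4*6)%AC).
Qed.

Let mulDr : right_distributive unitization_mul +%R.
Proof.
move=> [l a] [m b] [n c]; congr pair => /=; first by rewrite mulrDr.
by rewrite amulDr !scalerDl !scalerDr !addrA [LHS](ACl (1*3*5*2*4*6)%AC).
Qed.

Let one_neq0 : unitization_one != 0.
Proof. by apply/eqP => -[/eqP]; rewrite oner_eq0. Qed.

HB.instance Definition _ := GRing.Zmodule_isNzRing.Build (unitization A)
  mulA mul1 mulr1 mulDl mulDr one_neq0.

Let scaleAl (c : R[i]) x y : c *: (x * y) = c *: x * y.
Proof.
case: x y => l a [m b]; congr pair => /=; first by rewrite -mulrA.
by rewrite !scalerDr amulZl !scalerA (mulrC m c).
Qed.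

HB.instance Definition _ := GRing.Lmodule_isLalgebra.Build R[i] (unitization A)
  scaleAl.

Let scaleAr (c : R[i]) x y : c *: (x * y) = x * (c *: y).
Proof.
case: x y => l a [m b]; congr pair => /=; first by rewrite mulrCA.
by rewrite !scalerDr amulZr !scalerA (mulrC l c).
Qed.

HB.instance Definition _ := GRing.Lalgebra_isAlgebra.Build R[i] (unitization A)
  scaleAr.

Lemma unitization_starK : involutive unitization_star.
Proof. by move=> [l a]; congr pair => /=; rewrite ?conjCK ?astarK. Qed.

Lemma unitization_starD : {morph unitization_star : x y / x + y}.
Proof. by move=> [l a] [m b]; congr pair => /=; rewrite ?rmorphD ?astarD. Qed.

Lemma unitization_starZ (c : R[i]) x :
  unitization_star (c *: x) = c^* *: unitization_star x.
Proof. by case: x => l a; congr pair => /=; rewrite ?rmorphM ?astarZ. Qed.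

Lemma unitization_starM x y :
  unitization_star (x * y) = unitization_star y * unitization_star x.
Proof.
case: x y => [l a] [m b]; congr pair => /=; first by rewrite rmorphM mulrC.
by rewrite !astarD !astarZ astarM [X in X + _]addrC.
Qed.

Definition unitization_inj (a : A) : unitization A := (0, a).

Lemma unitization_injD a b :
  unitization_inj (a + b) = unitization_inj a + unitization_inj b.
Proof. by congr pair; rewrite /= addr0. Qed.

Lemma unitization_injB a b :
  unitization_inj (a - b) = unitization_inj a - unitization_inj b.
Proof. by congr pair; rewrite /= subr0. Qed.

Lemma unitization_injZ (c : R[i]) a :
  unitization_inj (c *: a) = c *: unitization_inj a.
Proof. by congr pair; rewrite /= scaler0. Qed.

Lemma unitization_injM a b :
  unitization_inj (a ** b) = unitization_inj a * unitization_inj b.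
Proof. by congr pair => /=; rewrite ?mulr0 // !scale0r !add0r. Qed.

Lemma unitization_inj_star a :
  unitization_inj (astar a) = unitization_star (unitization_inj a).
Proof. by congr pair; rewrite /= rmorph0. Qed.

End unitization_algebra.

Lemma unitization_inj_inj (R : realType) (A : starAlgType R) :
  injective (@unitization_inj R A).
Proof. by move=> a b []. Qed.

Lemma unitization_injN (R : realType) (A : starAlgType R) (a : A) :
  unitization_inj (- a) = - unitization_inj a.
Proof. by congr pair; rewrite /= oppr0. Qed.

(** An identity in an algebra without unit is checked in its unitization, which is a ring. *)
Ltac star_ring := apply: unitization_inj_inj;
  rewrite ?(unitization_injN, unitization_injD, unitization_injM); nc_ring.

Section cstar_seminorm_theory.
Context (R : realType) (A : starAlgType R) (p : A -> R).
Hypothesis hp : cstar_seminorm p.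
Implicit Types (a b c : A) (t : R) (x y : unitization A).

Lemma csn_ge0 a : 0 <= p a. Proof. by case: hp => h _ _ _ _; exact: h. Qed.
Lemma csnD a b : p (a + b) <= p a + p b.
Proof. by case: hp => _ h _ _ _; exact: h. Qed.
Lemma csnZ (c : R[i]) a : p (c *: a) = Normc.normc c * p a.
Proof. by case: hp => _ _ h _ _; exact: h. Qed.
Lemma csnM a b : p (a ** b) <= p a * p b.
Proof. by case: hp => _ _ _ h _; exact: h. Qed.
Lemma csn_star_mul a : p (astar a ** a) = p a ^+ 2.
Proof. by case: hp => _ _ _ _ h; exact: h. Qed.

Lemma csn0 : p 0 = 0.
Proof. by rewrite -(scale0r (0 : A)) csnZ Normc.normc0 mul0r. Qed.

Lemma csnN a : p (- a) = p a.
Proof. by rewrite -scaleN1r csnZ normcN Normc.normc1 mul1r. Qed.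

Lemma csnB a b : p (a - b) <= p a + p b.
Proof. by rewrite -(csnN b); exact: csnD. Qed.

Lemma csnZr t a : p (t%:C *: a) = `|t| * p a.
Proof. by rewrite csnZ normc_realC. Qed.

Lemma csn_star a : p (astar a) = p a.
Proof.
suff h b : p b <= p (astar b).
  by apply/eqP; rewrite eq_le h andbT; have := h (astar a); rewrite astarK.
have [b0|b0] := eqVneq (p b) 0; first by rewrite b0 csn_ge0.
have bp : 0 < p b by rewrite lt0r b0 csn_ge0.
by rewrite -(ler_pM2r bp) -expr2 -csn_star_mul csnM.
Qed.

Definition unitization_act x b := x.1 *: b + x.2 ** b.
Local Notation act := unitization_act.

Lemma unitization_actD x y b : act (x + y) b = act x b + act y b.
Proof. by rewrite /act scalerDl amulDl addrACA. Qed.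

Lemma unitization_actZ (k : R[i]) x b : act (k *: x) b = k *: act x b.
Proof. by rewrite /act /= -scalerA amulZl scalerDr. Qed.

Lemma unitization_actM x y b : act (x * y) b = act x (act y b).
Proof.
case: x y => l a [m c]; rewrite /act /=.
by rewrite !amulDl !amulDr !scalerDr !amulZl !amulZr !scalerA amulA !addrA.
Qed.

Lemma unitization_act_star x b c :
  astar (act x b) ** c = astar b ** act (unitization_star x) c.
Proof.
by rewrite /act astarD astarZ astarM amulDl amulDr amulZl amulZr amulA.
Qed.

(* The norm of left multiplication by [x] on [A]: unlike [`|x.1| + p x.2], it
   satisfies the C*-identity. *)
Definition unitization_norm x := sup [set p (act x b) | b in [set b | p b <=
  1]].
Local Notation N := unitization_norm.

Let act_bound x b : p (act x b) <= (Normc.normc x.1 + p x.2) * p b.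
Proof.
by rewrite mulrDl; apply: le_trans (csnD _ _) _; rewrite csnZ lerD2l csnM.
Qed.

Let act0 x : p (act x 0) = 0.
Proof. by rewrite /act scaler0 amulr0 addr0 csn0. Qed.

Lemma unitization_norm_ge0 x : 0 <= N x.
Proof.
rewrite -(act0 x); apply: ub_le_sup; last by exists 0 => //=;
  rewrite csn0 ler01.
exists (Normc.normc x.1 + p x.2) => _ [b /= b1 <-].
apply: le_trans (act_bound _ _) _; rewrite ler_piMr // addr_ge0 ?csn_ge0 //.
exact: normc_ge0.
Qed.

Lemma unitization_normP x b : p (act x b) <= N x * p b.
Proof.
have [b0|b0] := eqVneq (p b) 0.
  by have := act_bound x b; rewrite b0 !mulr0.
have bp : 0 < p b by rewrite lt0r b0 csn_ge0.
have : p (act x ((p b)^-1%:C *: b)) <= N x.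
  apply: ub_le_sup; last first.
    by eexists => //=; rewrite csnZr gtr0_norm ?invr_gt0 // mulVf.
  exists (Normc.normc x.1 + p x.2) => _ [c /= c1 <-].
  apply: le_trans (act_bound _ _) _; rewrite ler_piMr // addr_ge0 ?csn_ge0 //.
  exact: normc_ge0.
have -> : act x ((p b)^-1%:C *: b) = (p b)^-1%:C *: act x b.
  by rewrite /act amulZr scalerDr !scalerA mulrC.
by rewrite csnZr gtr0_norm ?invr_gt0 // ler_pdivrMl // mulrC.
Qed.

Lemma unitization_norm_le x k : 0 <= k -> (forall b, p (act x b) <= k * p b) ->
  N x <= k.
Proof.
move=> k0 H; apply: ge_sup.
  by exists (p (act x 0)), 0 => //=; rewrite csn0 ler01.
move=> _ [b /= b1 <-]; apply: le_trans (H b) _.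
by rewrite ler_piMr.
Qed.

Lemma unitization_normD x y : N (x + y) <= N x + N y.
Proof.
apply: unitization_norm_le => [|b];
  first by rewrite addr_ge0 ?unitization_norm_ge0.
by rewrite unitization_actD mulrDl (le_trans (csnD _ _)) // lerD
  ?unitization_normP.
Qed.

Lemma unitization_normZ (k : R[i]) x : N (k *: x) <= Normc.normc k * N x.
Proof.
apply: unitization_norm_le => [|b].
  by rewrite mulr_ge0 ?unitization_norm_ge0 // normc_ge0.
rewrite unitization_actZ csnZ -mulrA ler_wpM2l ?unitization_normP //.
exact: normc_ge0.
Qed.

Lemma unitization_normM x y : N (x * y) <= N x * N y.
Proof.
apply: unitization_norm_le => [|b];
  first by rewrite mulr_ge0 ?unitization_norm_ge0.
rewrite unitization_actM; apply: le_trans (unitization_normP _ _) _.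
by rewrite -mulrA ler_wpM2l ?unitization_norm_ge0 // unitization_normP.
Qed.

(** The C*-identity of [p] moves inside the supremum: p(x b)^2 is p of astar b times (star x) x b,
    hence at most N((star x) x) p(b)^2. *)
Lemma unitization_norm_star x : N x ^+ 2 <= N (unitization_star x * x).
Proof.
rewrite -(sqr_sqrtr (unitization_norm_ge0 (_ * x))) ler_sqr ?nnegrE ?sqrtr_ge0
  ?unitization_norm_ge0 //.
apply: unitization_norm_le => [|b]; first exact: sqrtr_ge0.
rewrite -ler_sqr ?nnegrE ?mulr_ge0 ?sqrtr_ge0 ?csn_ge0 // exprMn sqr_sqrtr
  ?unitization_norm_ge0 //.
rewrite -csn_star_mul unitization_act_star -unitization_actM.
apply: le_trans (csnM _ _) _; rewrite csn_star expr2 mulrCA ler_wpM2l ?csn_ge0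
  //.
exact: unitization_normP.
Qed.

Lemma unitization_norm_inj a : N (unitization_inj a) = p a.
Proof.
have actE b : act (unitization_inj a) b = a ** b by rewrite /act scale0r add0r.
apply/eqP; rewrite eq_le; apply/andP; split.
  by apply: unitization_norm_le => [|b]; rewrite ?csn_ge0 // actE csnM.
have [a0|a0] := eqVneq (p a) 0; first by rewrite a0 unitization_norm_ge0.
have ap : 0 < p a by rewrite lt0r a0 csn_ge0.
(* Up to scaling, the supremum is attained at [astar a]. *)
have := unitization_normP (unitization_inj a) (astar a).
rewrite actE -{1}(astarK a) csn_star_mul csn_star expr2.
by rewrite ler_pM2r.
Qed.

(** Self-adjointness is exact here, but positivity is only that of the class of [a] modulo the
    kernel of [p]. *)
Definition posA a := pos (@unitization_star R A) N (unitization_inj a).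

Lemma unitization_cstar_norm : cstar_norm (@unitization_star R A) N.
Proof.
by split; [exact: unitization_starK|exact: unitization_starD
  |exact: unitization_starZ|exact: unitization_starM|exact: unitization_norm_ge0
  |exact: unitization_normD|exact: unitization_normZ|exact: unitization_normM
  |exact: unitization_norm_star].
Qed.
Let hN := unitization_cstar_norm.

Lemma posA_star_mul a : posA (astar a ** a).
Proof.
by rewrite /posA unitization_injM unitization_inj_star;
  exact: pos_star_mul hN _.
Qed.

Lemma positive_posA a : positive_elt a -> posA a.
Proof. by move=> [c _ ->]; exact: posA_star_mul. Qed.

Lemma posA0 : posA 0.
Proof. by rewrite -(amul0r 0) -{1}astar0; exact: posA_star_mul. Qed.

Lemma posA_add a b : posA a -> posA b -> posA (a + b).
Proof. by rewrite /posA unitization_injD; exact: pos_add hN _ _. Qed.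

Lemma posAZ t a : 0 <= t -> posA a -> posA (t%:C *: a).
Proof. by rewrite /posA unitization_injZ; exact: posZ hN _ _. Qed.

Lemma posA_le a b : posA a -> posA (b - a) -> p a <= p b.
Proof.
rewrite -!unitization_norm_inj /posA unitization_injB;
  exact: pos_le_cnorm hN _ _.
Qed.

(** Conjugate t - a >= 0 by z; the scalar t lives only in the unitization. *)
Lemma posA_conj_le a z t : astar a = a -> p a <= t ->
  posA (t%:C *: (astar z ** z) - astar z ** a ** z).
Proof.
move=> sa at_; rewrite /posA.
have -> : unitization_inj (t%:C *: (astar z ** z) - astar z ** a ** z) =
  unitization_star (unitization_inj z) * (t%:C%:A - unitization_inj a)
    * unitization_inj z.
  rewrite mulrBr mulrBl -scalerAr mulr1 -scalerAl -!unitization_inj_star.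
  by rewrite unitization_injB unitization_injZ !unitization_injM.
apply: (pos_conj hN); apply: (pos_real_sub hN).
  by rewrite -unitization_inj_star sa.
by rewrite unitization_norm_inj.
Qed.
End cstar_seminorm_theory.

(** * Cauchy-Schwarz and bounded operators *)

Section prehilbert_theory.
Context (R : realType) (A : locallyCStarType R) (E : preHilbertModType A).
Implicit Types (x y z : E) (T S H : adjointable E).

Lemma innerN x y : inner x (- y) = - inner x y.
Proof. by rewrite -scaleN1r innerZ scaleN1r. Qed.

Lemma innerB x y z : inner x (y - z) = inner x y - inner x z.
Proof. by rewrite innerD innerN. Qed.

Lemma innerBl x y z : inner (x - y) z = inner x z - inner y z.
Proof. by rewrite -inner_star innerB astarB !inner_star. Qed.

Lemma inner0 x : inner x 0 = 0.
Proof. by rewrite -(subrr x) innerB subrr. Qed.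

Lemma inner_realZl (t : R) x y : inner (t%:C *: x) y = t%:C *: inner x y.
Proof. by rewrite innerZl conj_realC. Qed.

Lemma adj0 T : T 0 = 0.
Proof. by rewrite -(scale0r (0 : E)) adjZ !scale0r. Qed.

Lemma adjN T x : T (- x) = - T x.
Proof. by rewrite -scaleN1r adjZ scaleN1r. Qed.

Lemma adjB T x y : T (x - y) = T x - T y.
Proof. by rewrite adjD adjN. Qed.

Lemma adj_ract T x (a : A) : T (ract x a) = ract (T x) a.
Proof. by case: (adj_funP T) => _ ->. Qed.

Definition adj_id : adjointable E :=
  mk_adjointable (fun x y => erefl : inner (id x) y = inner x (id y)).

Section one_seminorm.
Variable p : A -> R.
Hypothesis hp : cstar_seminorm p.
Local Notation bp := (bar_seminorm p).

(** Expand the form at x a - t y with a = <x, H y>, bound astar a <x, H x> a by t astar a a, and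
    divide by t. With [H] the identity this is Cauchy-Schwarz for the inner product; a general [H]
    serves to bound positive operators. *)
Lemma cauchy_schwarz_pos H x y (t : R) :
  is_adjoint H H -> (forall z, posA p (inner z (H z))) ->
  0 < t -> p (inner x (H x)) <= t ->
  posA p (t%:C *: inner y (H y) - astar (inner x (H y)) ** inner x (H y)).
Proof.
move=> sH pH t0 xt; set a := inner x (H y).
have aE : astar a = inner y (H x) by rewrite inner_star sH.
have := pH (ract x a - t%:C *: y).
have -> : inner (ract x a - t%:C *: y) (H (ract x a - t%:C *: y)) =
   (astar a ** inner x (H x) ** a - t%:C *: (astar a ** a))
   + (t%:C *: (t%:C *: inner y (H y)) - t%:C *: (astar a ** a)).
  rewrite adjB adj_ract adjZ innerBl !innerB !innerMl !innerM !inner_realZl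
    !innerZ.
  by rewrite -/a -aE amulZr amulZl amulA opprB.
have sxx : astar (inner x (H x)) = inner x (H x) by rewrite inner_star sH.
move=> /(posA_add hp); move/(_ _ (posA_conj_le hp a sxx xt)).
set P := _ ** _ ** a; set Q := t%:C *: (_ ** a); clearbody P => h.
have : posA p (t^-1%:C *: (t%:C *: (t%:C *: inner y (H y)) - Q)).
  apply: (posAZ hp); first by rewrite invr_ge0 ltW.
  by move: h; congr (posA p _); clearbody Q; star_ring.
rewrite scalerBr !scalerA -!rmorphM /= mulrA mulVf ?gt_eqF // mul1r.
by rewrite scale1r.
Qed.

Lemma cauchy_schwarz_form H x y :
  is_adjoint H H -> (forall z, posA p (inner z (H z))) ->
  p (inner x (H y)) ^+ 2 <= p (inner x (H x)) * p (inner y (H y)).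
Proof.
move=> sH pH; apply/ler_addgt0Pr => e e0.
set s := p (inner x (H x)); set n := p (inner y (H y)).
have n1 : 0 < n + 1 by rewrite ltr_wpDl ?csn_ge0.
(* The bound t must be positive while s may vanish; the excess, multiplied by n, costs at most e. *)
have t0 : 0 < s + e / (n + 1) by rewrite ltr_wpDl ?csn_ge0 // divr_gt0.
have st : s <= s + e / (n + 1) by rewrite lerDl ltW // divr_gt0.
have := posA_le hp (posA_star_mul hp _) (cauchy_schwarz_pos y sH pH t0 st).
rewrite csn_star_mul // csnZr // gtr0_norm // -/n => h; apply: le_trans h _.
rewrite mulrDl lerD2l mulrAC ler_pdivrMr // ler_wpM2l ?lerDl //.
exact: ltW.
Qed.

Lemma bar_ge0 x : 0 <= bp x. Proof. exact: sqrtr_ge0. Qed.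

Lemma bar_sqr x : bp x ^+ 2 = p (inner x x).
Proof. by rewrite sqr_sqrtr // csn_ge0. Qed.

Lemma inner_bound x y : p (inner x y) <= bp x * bp y.
Proof.
rewrite -ler_sqr ?nnegrE ?mulr_ge0 ?bar_ge0 ?csn_ge0 // exprMn !bar_sqr.
apply: (@cauchy_schwarz_form adj_id) => // z.
exact: (positive_posA hp (inner_ge0 z)).
Qed.

Lemma barD x y : bp (x + y) <= bp x + bp y.
Proof.
rewrite -ler_sqr ?nnegrE ?addr_ge0 ?bar_ge0 // bar_sqr innerDl !innerD.
have h := inner_bound x y; have h' := inner_bound y x.
apply: le_trans (csnD hp _ _) _; rewrite sqrrD !bar_sqr.
have := csnD hp (inner x x) (inner x y);
  have := csnD hp (inner y x) (inner y y).
set u := bp x * bp y in h *; rewrite mulrC -/u in h'; lra.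
Qed.

Lemma barZ (c : R[i]) x : bp (c *: x) = Normc.normc c * bp x.
Proof.
rewrite /bar_seminorm innerZl innerZ !csnZ // mulrA.
have -> : Normc.normc c^* * Normc.normc c = Normc.normc c ^+ 2.
  rewrite expr2; congr (_ * _); case: c => a b.
  by rewrite /Num.conj /= sqrrN.
by rewrite sqrtrM ?sqr_ge0 // sqrtr_sqr ger0_norm ?normc_ge0.
Qed.

Lemma barZr (t : R) x : bp (t%:C *: x) = `|t| * bp x.
Proof. by rewrite barZ normc_realC. Qed.

Lemma barN x : bp (- x) = bp x.
Proof. by rewrite -scaleN1r barZ normcN Normc.normc1 mul1r. Qed.

Lemma barB x y : bp (x - y) <= bp x + bp y.
Proof. by rewrite -(barN y); exact: barD. Qed.

Lemma bar0 : bp (0 : E) = 0.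
Proof. by rewrite /bar_seminorm inner0 csn0 // sqrtr0. Qed.

Lemma bar_ract x (a : A) : bp (ract x a) <= bp x * p a.
Proof.
rewrite -ler_sqr ?nnegrE ?mulr_ge0 ?bar_ge0 ?csn_ge0 // exprMn !bar_sqr.
rewrite innerMl innerM amulA mulrC; apply: le_trans (csnM hp _ _) _.
rewrite expr2 -mulrA ![p a * _]mulrC -{2}(csn_star hp a) ler_wpM2r ?csn_ge0 //.
by rewrite mulrC csnM.
Qed.

Definition op_bounded T (c : R) := forall x, bp (T x) <= c * bp x.

Lemma op_boundedW T c d : c <= d -> op_bounded T c -> op_bounded T d.
Proof.
by move=> cd Tc x; apply: le_trans (Tc x) _; rewrite ler_wpM2r ?bar_ge0.
Qed.

Lemma op_boundedD T S c d : op_bounded T c -> op_bounded S d ->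
  op_bounded (T + S) (c + d).
Proof.
by move=> Tc Sd x; rewrite mulrDl; apply: le_trans (barD _ _) (lerD _ _).
Qed.

Lemma op_boundedZ (k : R[i]) T c : op_bounded T c ->
  op_bounded (k *: T) (Normc.normc k * c).
Proof.
by move=> Tc x; rewrite barZ -mulrA ler_wpM2l ?normc_ge0.
Qed.

Lemma op_boundedN T c : op_bounded T c -> op_bounded (- T) c.
Proof.
move=> /(op_boundedZ (-1)).
by rewrite normcN Normc.normc1 mul1r scaleN1r.
Qed.

Lemma op_boundedB T S c d : op_bounded T c -> op_bounded S d ->
  op_bounded (T - S) (c + d).
Proof. by move=> Tc /op_boundedN; exact: op_boundedD. Qed.

Lemma op_boundedM T S c d : 0 <= c -> op_bounded T c -> op_bounded S d ->
  op_bounded (T ** S) (c * d).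
Proof.
move=> c0 Tc Sd x; apply: le_trans (Tc _) _.
by rewrite -mulrA ler_wpM2l.
Qed.

Lemma op_bounded_adjoint T S c : 0 <= c -> is_adjoint T S ->
  op_bounded T c -> op_bounded S c.
Proof.
move=> c0 TS Tc x.
have [x0|x0] := eqVneq (bp (S x)) 0; first by rewrite x0 mulr_ge0 ?bar_ge0.
have xp : 0 < bp (S x) by rewrite lt0r x0 bar_ge0.
rewrite -(ler_pM2r xp) -expr2 bar_sqr -TS.
apply: le_trans (inner_bound _ _) _;
  rewrite [leRHS]mulrAC ler_wpM2r ?bar_ge0 //.
Qed.

Lemma op_bounded_theta x y : op_bounded (theta x y) (bp x * bp y).
Proof.
move=> z; apply: le_trans (bar_ract _ _) _.
by rewrite -mulrA ler_wpM2l ?bar_ge0 // inner_bound.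
Qed.

(** Cauchy-Schwarz for the form of [H] at x and H x bounds |H x|^4 by (m |x|^2) (m |H x|^2). *)
Lemma op_bounded_form H (m : R) : is_adjoint H H -> 0 <= m ->
  (forall x, posA p (inner x (H x))) ->
  (forall x, posA p (m%:C *: inner x x - inner x (H x))) -> op_bounded H m.
Proof.
move=> sH m0 pH mH x.
have h z : p (inner z (H z)) <= m * bp z ^+ 2.
  rewrite bar_sqr; have := posA_le hp (pH z) (mH z).
  by rewrite csnZr // ger0_norm.
have := cauchy_schwarz_form x (H x) sH pH.
rewrite -sH -bar_sqr => cs.
rewrite -ler_sqr ?nnegrE ?mulr_ge0 ?bar_ge0 //.
have [x0|x0] := eqVneq (bp (H x) ^+ 2) 0; first by rewrite x0 sqr_ge0.
have xp : 0 < bp (H x) ^+ 2 by rewrite lt0r x0 sqr_ge0.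
rewrite -(ler_pM2r xp) -expr2; apply: le_trans cs _.
rewrite exprMn [_ ^+ 2 * _]mulrC [m ^+ 2]expr2 -mulrA -!mulrA mulrA.
have -> : bp x ^+ 2 * (m * (m * bp (H x) ^+ 2)) =
  (m * bp x ^+ 2) * (m * bp (H x) ^+ 2) by ring.
by apply: ler_pM; rewrite ?csn_ge0.
Qed.

Lemma op_seminormP T (c : R) : 0 <= c ->
  (op_seminorm p T <= c%:E)%E <-> op_bounded T c.
Proof.
move=> c0; split=> [H x|H]; last first.
  apply: ge_ereal_sup => _ [x /= x1 <-]; rewrite lee_fin.
  by apply: le_trans (H x) _; rewrite ler_piMr.
have h z : bp z <= 1 -> bp (T z) <= c.
  move=> z1; rewrite -lee_fin; apply: le_trans H.
  by apply: ereal_sup_ubound; exists z.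
have [x0|x0] := eqVneq (bp x) 0.
  (* All multiples of x lie in the unit ball, so a non-zero value at x could be scaled up to c +
     1. *)
  rewrite x0 mulr0 leNgt; apply/negP => Tx0.
  have := h (((c + 1) / bp (T x))%:C *: x).
  rewrite barZr x0 mulr0 ler01 adjZ barZr gtr0_norm ?divr_gt0 ?ltr_wpDl //.
  by rewrite divfK ?gt_eqF // => /(_ erefl); rewrite gerDl ler10.
have xp : 0 < bp x by rewrite lt0r x0 bar_ge0.
have := h ((bp x)^-1%:C *: x).
rewrite barZr adjZ barZr gtr0_norm ?invr_gt0 // mulVf // lexx => /(_ erefl).
by rewrite ler_pdivrMl // mulrC.
Qed.

Lemma op_seminorm_ge0 T : (0%E <= op_seminorm p T)%E.
Proof.
by apply: ereal_sup_ubound; exists 0; rewrite /= ?adj0 ?bar0 ?ler01.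
Qed.

(** Meaningful only for bounded operators: [fine] sends an infinite value to 0. *)
Definition op_norm T : R := fine (op_seminorm p T).

Lemma op_norm_ge0 T : 0 <= op_norm T.
Proof. by rewrite fine_ge0 // op_seminorm_ge0. Qed.

Lemma op_norm_le T c : 0 <= c -> op_bounded T c -> op_norm T <= c.
Proof.
move=> c0 /(op_seminormP _ c0) H; rewrite -lee_fin fineK //.
by rewrite ge0_fin_numE ?op_seminorm_ge0 //; apply: le_lt_trans H _;
  rewrite ltry.
Qed.

Lemma op_seminorm_fin T c : 0 <= c -> op_bounded T c ->
  op_seminorm p T = (op_norm T)%:E.
Proof.
move=> c0 /(op_seminormP _ c0) H; rewrite fineK //.
by rewrite ge0_fin_numE ?op_seminorm_ge0 //; apply: le_lt_trans H _;
  rewrite ltry.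
Qed.

Lemma op_normP T c : 0 <= c -> op_bounded T c -> op_bounded T (op_norm T).
Proof.
move=> c0 H; apply/op_seminormP; first exact: op_norm_ge0.
by rewrite (op_seminorm_fin c0 H).
Qed.

End one_seminorm.

(* Iterating Cauchy-Schwarz along the powers [(T*T)^(2^k)] removes the constant
   [C], as for the spectral radius. *)
Lemma op_bounded_mono (p q : A -> R) (C : R) T t :
  cstar_seminorm p -> cstar_seminorm q -> (forall a, p a <= C * q a) ->
  0 <= t -> op_bounded q T t -> op_bounded p T t.
Proof.
move=> hp hq pq t0 Tt x.
pose H := adjoint T ** T; pose B : E -> R := bar_seminorm p.
have Ht : op_bounded q H (t * t).
  apply: op_boundedM => //; exact: op_bounded_adjoint (adjointP T) _.
have sH y z : inner (H y) z = inner y (H z).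
  by rewrite /= -!adjointP (is_adjointC (adjointP T)).
have [x0|x0] := eqVneq (B x) 0.
  rewrite -/(B x) x0 mulr0 -sqrtr0; apply: ler_wsqrtr.
  rewrite adjointP; apply: le_trans (inner_bound hp _ _) _.
  by rewrite -/(B x) x0 mul0r.
have xp : 0 < B x by rewrite lt0r x0 bar_ge0.
pose u n := B (iter n H x) / B x.
have u0 n : 0 <= u n by rewrite divr_ge0 ?bar_ge0.
have sHn n y z : inner (iter n H y) z = inner y (iter n H z).
  by elim: n y z => // n IH y z; rewrite iterS sH IH -iterSr.
have uu n : u n ^+ 2 <= u (n + n)%N.
  rewrite expr_div_n ler_pdivrMr ?exprn_gt0 // bar_sqr // sHn -iterD.
  apply: le_trans (inner_bound hp _ _) _.
  by rewrite expr2 mulrA divfK // mulrC.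
have u2 k : u 1 ^+ (2 ^ k) <= u (2 ^ k)%N.
  elim: k => [|k IH]; first by rewrite expn0 expr1.
  rewrite expnS mulnC exprM; apply: (@le_trans _ _ (u (2 ^ k)%N ^+ 2)).
    by rewrite lerXn2r ?nnegrE ?exprn_ge0.
  by rewrite muln2 -addnn.
have qn n : bar_seminorm q (iter n H x) <= (t * t) ^+ n * bar_seminorm q x.
  elim: n => [|n IH]; first by rewrite mul1r.
  rewrite iterS exprS -mulrA; apply: le_trans (Ht _) _.
  by rewrite ler_wpM2l // mulr_ge0.
have pB y : B y <= Num.sqrt `|C| * bar_seminorm q y.
  rewrite -sqrtrM //; apply: ler_wsqrtr; apply: le_trans (pq _) _.
  by rewrite ler_wpM2r ?csn_ge0 // ler_norm.
have u1 : u 1 <= t * t.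
  apply: (@pow_le_mul _ _ _ (Num.sqrt `|C| * bar_seminorm q x / B x)) => //.
    exact: mulr_ge0.
  move=> n; exists (2 ^ n)%N; first exact/ltnW/ltn_expl.
  apply: le_trans (u2 _) _; rewrite ler_pdivrMr // mulrAC divfK // -mulrA.
  rewrite [X in _ * X]mulrC; apply: le_trans (pB _) _.
  by rewrite ler_wpM2l ?sqrtr_ge0.
rewrite -ler_sqr ?nnegrE ?mulr_ge0 ?bar_ge0 // bar_sqr // adjointP.
apply: le_trans (inner_bound hp _ _) _.
move: u1; rewrite /u ler_pdivrMr // /H /= -/(B x) => h.
by rewrite exprMn mulrC expr2 [B x ^+ 2]expr2 mulrA ler_wpM2r ?bar_ge0.
Qed.

End prehilbert_theory.

Lemma cvg0_lt (R : realType) (T : Type) (F : set_system T) (f : T -> R) :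
  Filter F -> f x @[x --> F] --> (0 : R) <->
  forall e, 0 < e -> F [set x | `|f x| < e].
Proof. by move=> FF; exact: cvgr0Pnorm_lt. Qed.

Lemma countable_enum (T : Type) (A : set T) (x0 : T) : countable A ->
  exists2 g : nat -> T, (forall x, A x -> exists n, g n = x)
    & forall n, A (g n) \/ g n = x0.
Proof.
move=> /countable_injP[f finj].
pose P n x := A x /\ f x = n.
have /choice[g gP] : forall n, exists x, (exists y, P n y) /\ P n x \/
    ~ (exists y, P n y) /\ x = x0.
  move=> n; have [[y py]|H] := pselect (exists y, P n y).
    by exists y; left; split => //; exists y.
  by exists x0; right.
exists g => [x Ax|n].
  exists (f x); case: (gP (f x)) => [[_ [Ag fg]]|[[]]]; last by exists x.
  by apply: finj; rewrite ?inE.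
by case: (gP n) => [[_ [Ag _]]|[_ ->]]; [left|right].
Qed.

(** * Topologies given by seminorms *)

Section seminorm_topology.
Context (R : realType) (V : preTopologicalLmodType R[i]) (P : set (V -> R)).
Hypothesis dP : topology_determined_by P.

Lemma seminorm_ball_nbhs p (x : V) (e : R) : P p -> 0 < e ->
  nbhs x [set y | `|p (y - x)| < e].
Proof.
move=> Pp e0; have [+ _] := dP x (nbhs_filter x).
by move=> /(_ (fun U => id)) /(_ _ Pp) /cvg0_lt; apply.
Qed.

(** The topology is known only through convergence of filters. Along the filter generated by the
    [Q]-balls at x every p in [P] tends to 0, so this filter converges to x and contains each
    neighbourhood of x. *)
Lemma nbhs_seminorm_ball (Q : set (V -> R)) (x : V) (U : set V) :
  Q !=set0 ->
  (forall q r, Q q -> Q r -> exists2 s, Q s & forall v, q v <= s v /\ r v <=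
    s v) ->
  (forall p, P p -> exists2 q, Q q & forall v, `|p v| <= q v) ->
  nbhs x U -> exists2 q, Q q & exists2 e, 0 < e & forall y, q (y - x) < e ->
    U y.
Proof.
move=> [q0 Qq0] dQ PQ.
pose F : set_system V := [set U | exists2 q, Q q & exists2 e, 0 < e &
  forall y, q (y - x) < e -> U y].
have FF : Filter F.
  split.
  - by exists q0 => //; exists 1.
  - move=> U1 U2 [q Qq [e e0 H]] [r Qr [d d0 K]].
    have [s Qs sP] := dQ _ _ Qq Qr; exists s => //.
    exists (Num.min e d); first by rewrite lt_min e0 d0.
    move=> y; rewrite lt_min => /andP[h1 h2]; split.
      by apply: H; apply: le_lt_trans h1; case: (sP (y - x)).
    by apply: K; apply: le_lt_trans h2; case: (sP (y - x)).
  - move=> U1 U2 U12 [q Qq [e e0 H]]; exists q => //; exists e => // y /H.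
    exact: U12.
have [_ H] := dP x FF; apply: H => p Pp; apply/cvg0_lt => e e0.
have [q Qq pq] := PQ _ Pp; exists q => //; exists e => // y.
exact: le_lt_trans.
Qed.

End seminorm_topology.

(** * Continuous C*-seminorms on a locally C*-algebra *)

Section locally_cstar.
Context (R : realType) (A : locallyCStarType R).
Implicit Types (p q : A -> R) (a b : A).

Lemma csn_continuous_seminorm p : cstar_seminorm p ->
  (forall (x : A) (e : R), 0 < e -> nbhs x [set y | p (y - x) < e]) -> S_ A p.
Proof.
move=> hp H; split => //; apply: continuous_subspaceT => x.
apply/cvgrPdist_lt => e e0; apply: filterS (H x e e0) => y /= ye.
have h1 := csnD hp (y - x) x; have h2 := csnD hp (x - y) y.
rewrite subrK in h1; rewrite subrK -(csnN hp (x - y)) opprB in h2.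
by rewrite ltr_norml; lra.
Qed.

Lemma S_cstar p : S_ A p -> cstar_seminorm p. Proof. by case. Qed.

Lemma S_nbhs p (x : A) (e : R) : S_ A p -> 0 < e ->
  nbhs x [set y | p (y - x) < e].
Proof.
move=> Sp e0; have := seminorm_ball_nbhs (@lcstar_determined R A) x Sp e0.
by apply: filterS => y; rewrite /= ger0_norm // (csn_ge0 (S_cstar Sp)).
Qed.

Lemma csn_max p q : cstar_seminorm p -> cstar_seminorm q ->
  cstar_seminorm (fun a => Num.max (p a) (q a)).
Proof.
move=> hp hq; split.
- by move=> a _; rewrite le_max (csn_ge0 hp).
- move=> a b _ _; rewrite ge_max; apply/andP; split.
    by apply: le_trans (csnD hp _ _) _; rewrite lerD // le_max lexx ?orbT.
  by apply: le_trans (csnD hq _ _) _; rewrite lerD // le_max lexx ?orbT.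
- by move=> c a _; rewrite csnZ // (csnZ hq) maxr_pMr // normc_ge0.
- move=> a b _ _; rewrite ge_max; apply/andP; split.
    apply: le_trans (csnM hp _ _) _; apply: ler_pM; rewrite ?(csn_ge0 hp) //;
    by rewrite le_max lexx ?orbT.
  apply: le_trans (csnM hq _ _) _; apply: ler_pM; rewrite ?(csn_ge0 hq) //;
  by rewrite le_max lexx ?orbT.
- move=> a _; rewrite (csn_star_mul hp) (csn_star_mul hq).
  have h1 := csn_ge0 hp a; have h2 := csn_ge0 hq a.
  case: (leP (p a) (q a)) => h.
    by rewrite max_r // lerXn2r // ?nnegrE.
  by rewrite max_l // lerXn2r ?nnegrE // ltW.
Qed.

Lemma S_max p q : S_ A p -> S_ A q -> S_ A (fun a => Num.max (p a) (q a)).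
Proof.
move=> Sp Sq; apply: csn_continuous_seminorm; first by apply: csn_max;
  exact: S_cstar.
move=> x e e0; apply: filterS (filterI (S_nbhs x Sp e0) (S_nbhs x Sq e0)) => y
  [/= h1 h2].
by rewrite gt_max h1 h2.
Qed.

Lemma S_zero : S_ A (fun=> 0).
Proof.
apply: csn_continuous_seminorm; last by move=> x e e0;
  apply: filterS filterT => y.
by split=> // *; rewrite ?addr0 ?mulr0 ?expr0n.
Qed.

Lemma S_separating a : (forall p, S_ A p -> p a = 0) -> a = 0.
Proof.
move=> H; have h : principal_filter a --> (0 : A).
  apply/(@lcstar_determined R A) => p Sp; apply/cvg0_lt => e e0.
  by apply/principal_filterP; rewrite /= subr0 H // normr0.
apply: (@lcstar_hausdorff R A) => U W Ua W0.
exists a; split; first exact: nbhs_singleton.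
by have /principal_filterP := h _ W0.
Qed.

(** Members of a family that determines the topology are continuous, and their running maxima form
    an increasing sequence. Homogeneity turns an inclusion of balls into the inequality with a
    constant. *)
Lemma frechet_cofinal : frechet A -> exists q : nat -> A -> R,
  [/\ forall n, S_ A (q n), forall n m a, (n <= m)%N -> q n a <= q m a
    & forall p, S_ A p -> exists n C, forall a, p a <= C * q n a].
Proof.
move=> [P [cP Pc dP]].
have [g gP gn] := countable_enum (fun=> 0 : R) cP.
pose q := fix q n a := if n is m.+1 then Num.max (q m a) (g m a) else 0.
have Sg n : S_ A (g n).
  case: (gn n) => [Pg|->]; last exact: S_zero.
  apply: csn_continuous_seminorm; first exact: Pc.
  move=> x e e0; apply: filterS (seminorm_ball_nbhs dP x Pg e0) => y /=.
  by rewrite ger0_norm // (csn_ge0 (Pc _ Pg)).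
have Sq n : S_ A (q n).
  by elim: n => [|n IH]; [exact: S_zero|exact: S_max].
have qS n a : q n a <= q n.+1 a by rewrite le_max lexx.
have qle n m a : (n <= m)%N -> q n a <= q m a.
  move=> nm; rewrite -(subnKC nm); elim: (m - n)%N => [|k IH];
    first by rewrite addn0.
  by rewrite addnS; apply: le_trans IH _.
exists q; split => // p Sp.
have [_ [n _ <-] [e e0 H]] : exists2 r, range q r & exists2 e, 0 < e &
    forall y, r (y - 0) < e -> [set y | p (y - 0) < 1] y.
  apply: (nbhs_seminorm_ball dP).
  - by exists (q 0%N), 0%N.
  - move=> _ _ [n _ <-] [m _ <-]; exists (q (maxn n m));
    first by exists (maxn n m).
    by move=> v; rewrite !qle ?leq_maxl ?leq_maxr.
  - move=> r Pr; have [n gr] := gP _ Pr; exists (q n.+1); first by exists n.+1.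
    by move=> v; rewrite ger0_norm ?(csn_ge0 (Pc _ Pr)) //= -gr le_max lexx
      orbT.
  - exact: S_nbhs.
have hp := S_cstar Sp; have hq := S_cstar (Sq n).
exists n, (2 / e) => a; rewrite leNgt; apply/negP => qp.
have pa : 0 < p a by apply: le_lt_trans qp;
  rewrite mulr_ge0 ?(csn_ge0 hq) // divr_ge0 // ltW.
have h : (p a)^-1 * q n a < e.
  rewrite mulrC ltr_pdivrMr //; move: qp; rewrite mulrAC ltr_pdivrMr //.
  by have := csn_ge0 hq a; nra.
have := H ((p a)^-1%:C *: a); rewrite /= !subr0 !csnZr //.
by rewrite gtr0_norm ?invr_gt0 // mulVf ?gt_eqF // ltxx => /(_ h).
Qed.

End locally_cstar.

(** * Neighbourhoods in the space of adjointable operators *)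

Section operator_topology.
Context (R : realType) (A : locallyCStarType R) (E : preHilbertModType A).
Implicit Types (x y z : E) (T S F : adjointable E) (p q : A -> R).

Lemma bar_separating x : (forall p, S_ A p -> bar_seminorm p x = 0) -> x = 0.
Proof.
move=> H; apply/inner_eq0/S_separating => p Sp.
by rewrite -(bar_sqr (S_cstar Sp)) H // expr0n.
Qed.

Lemma bar_le_max p q x :
  bar_seminorm p x <= bar_seminorm (fun a => Num.max (p a) (q a)) x /\
  bar_seminorm q x <= bar_seminorm (fun a => Num.max (p a) (q a)) x.
Proof. by split; apply: ler_wsqrtr; rewrite le_max lexx ?orbT. Qed.

(** Both sides of the bound change with the seminorm, so domination by the maximum is not enough by
    itself; [op_bounded_mono] is applied with constant 1. *)
Lemma op_bounded_max p q T t : S_ A p -> S_ A q -> 0 <= t ->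
  op_bounded (fun a => Num.max (p a) (q a)) T t ->
  op_bounded p T t /\ op_bounded q T t.
Proof.
move=> Sp Sq t0 Tt; have Sm := S_max Sp Sq.
split; apply: (@op_bounded_mono _ _ _ _ _ 1 _ _ _ (S_cstar Sm)) => //;
  try exact: S_cstar; by move=> a; rewrite mul1r le_max lexx ?orbT.
Qed.

Lemma op_openE (U : set (adjointable E)) : open U ->
  exists D : set (set (adjointable E)),
    D `<=` finI_from (@op_balls R A E) id /\ \bigcup_(W in D) W = U.
Proof. by move=> [D DO DU]; exists D. Qed.

(** The subbasic balls have arbitrary centres. Finitely many of them containing T are replaced by
    one ball at T for the maximum of their seminorms, which [op_bounded_max] allows. *)
Lemma op_nbhsP T (U : set (adjointable E)) :
  nbhs T U <-> exists2 p, S_ A p & exists2 e, 0 < e &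
    forall S, op_bounded p (S - T) e -> U S.
Proof.
split; last first.
  move=> [p Sp [e e0 H]]; have hp := S_cstar Sp.
  rewrite nbhsE; exists (op_ball p T e); last first.
    move=> S; rewrite /op_ball /= => h; apply: H.
    apply/op_seminormP => //; [exact: ltW|exact: ltW].
  split; last first.
    rewrite /op_ball /= subrr.
    have : (op_seminorm p (0%R : adjointable E) <= 0%:E)%E.
      by apply/op_seminormP => // x; rewrite bar0 // mul0r.
    by move=> /le_lt_trans; apply; rewrite lte_fin.
  exists [set op_ball p T e]; last by rewrite bigcup_set1.
  by move=> _ ->; apply: (finI_from1 id); exists p, T, e.
rewrite nbhsE => -[V [/op_openE[D [DD <-]] [W DW WT] VU]].
have [B BB BW] := DD _ DW.
suff [p Sp [e e0 H]] : exists2 p, S_ A p & exists2 e, 0 < e &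
    forall S, op_bounded p (S - T) e ->
      forall C : set (adjointable E), C \in B -> C S.
  exists p => //; exists e => // S /H K; apply: VU; exists W => //.
  by rewrite -BW => C /K.
have TB : forall C : set (adjointable E), C \in B -> C T by move=> C CB;
  move: WT; rewrite -BW; apply.
have BO : forall C : set (adjointable E), C \in B ->
  op_balls C by move=> C /BB; rewrite inE.
have : forall s : seq (set (adjointable E)), {subset s <= B} ->
   exists2 p, S_ A p & exists2 e, 0 < e &
    forall S, op_bounded p (S - T) e ->
      forall C : set (adjointable E), C \in s -> C S.
  elim=> [|C s IH] sB; first by exists (fun=> 0); [exact: S_zero|exists 1].
  have [|p Sp [e e0 H]] := IH; first by move=> C' C's; apply: sB;
    rewrite inE C's orbT.
  have CB : C \in B by apply: sB; rewrite inE eqxx.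
  have [q [S0 [r [Sq r0 CE]]]] := BO _ CB.
  have := TB _ CB; rewrite CE /op_ball /= => Tr.
  have hq := S_cstar Sq.
  have h : (op_norm q (T - S0))%:E = op_seminorm q (T - S0).
    rewrite /op_norm fineK // ge0_fin_numE; last exact: op_seminorm_ge0.
    by apply: lt_trans Tr _; rewrite ltry.
  have hr : op_norm q (T - S0) < r by rewrite -lte_fin h.
  have hb : op_bounded q (T - S0) (op_norm q (T - S0)).
    by apply/op_seminormP; rewrite ?op_norm_ge0 // h.
  (* Half of the slack, because [op_bounded] is a non-strict bound and the ball is defined by a
     strict one. *)
  pose d := Num.min e ((r - op_norm q (T - S0)) / 2).
  have d0 : 0 < d by rewrite lt_min e0 divr_gt0 // subr_gt0.
  exists (fun a => Num.max (p a) (q a)); first exact: S_max.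
  exists d => // S /(op_bounded_max Sp Sq (ltW d0))[h1 h2] C'.
  rewrite inE => /predU1P[->|]; last first.
    move: C'; apply: H; apply: op_boundedW h1; last by rewrite ge_min lexx.
  rewrite /=; have h3 := op_boundedD hq h2 hb; rewrite addrA subrK in h3.
  apply: le_lt_trans (_ : (_ <= (d + op_norm q (T - S0))%:E)%E) _.
    by apply/op_seminormP => //; rewrite addr_ge0 ?op_norm_ge0 // ltW.
  rewrite lte_fin -ltrBrDr; apply: (@le_lt_trans _ _ ((r - op_norm q (T - S0))
    / 2)).
    by rewrite ge_min lexx orbT.
  by rewrite ltr_pdivrMr // mulr_natr mulr2n ltrDl subr_gt0.
by move=> /(_ (enum_fset B)); apply.
Qed.

End operator_topology.

Section hilbert_topology.
Context (R : realType) (A : locallyCStarType R) (E : hilbertModType A).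
Implicit Types (x y z : E) (T S F : adjointable E) (p q : A -> R).

Lemma bar_nbhs p x (e : R) : S_ A p -> 0 < e ->
  nbhs x [set y | bar_seminorm p (y - x) < e].
Proof.
move=> Sp e0; have Pp : [set (bar_seminorm p : E ->
  R) | p in S_ A] (bar_seminorm p).
  by exists p.
have := seminorm_ball_nbhs (@hilbert_determined R A E) x Pp e0.
by apply: filterS => y; rewrite /= ger0_norm // sqrtr_ge0.
Qed.

Lemma nbhs_bar x (U : set E) : nbhs x U ->
  exists2 p, S_ A p & exists2 e, 0 < e &
  forall y, bar_seminorm p (y - x) < e -> U y.
Proof.
move=> xU.
pose Q := [set (bar_seminorm p : E -> R) | p in S_ A].
have [||p [p' Sp' <-]|_ [p Sp <-] [e e0 H]] :=
  nbhs_seminorm_ball (@hilbert_determined R A E) (Q := Q) _ _ _ xU.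
- by exists (bar_seminorm (fun=> 0)), (fun=> 0) => //; exact: S_zero.
- move=> _ _ [p Sp <-] [q Sq <-].
  exists (bar_seminorm (fun a => Num.max (p a) (q a))); last exact: bar_le_max.
  by exists (fun a => Num.max (p a) (q a)) => //; exact: S_max.
- by exists (bar_seminorm p'); [exists p'|move=> v;
  rewrite ger0_norm ?sqrtr_ge0].
by exists p => //; exists e.
Qed.

Lemma hilbert_seq_complete (u : nat -> E) :
  (forall p (e : R), S_ A p -> 0 < e -> exists n0, forall n m,
     (n0 <= n)%N -> (n0 <= m)%N -> bar_seminorm p (u n - u m) < e) ->
  exists x, forall p (e : R), S_ A p -> 0 < e -> exists n0, forall n,
     (n0 <= n)%N -> bar_seminorm p (u n - x) < e.
Proof.
move=> cu.
have [x ux] : exists x, u @ \oo --> x.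
  apply: hilbert_complete.
  apply/(@hilbert_determined R A E) => _ [p Sp <-]; apply/cvg0_lt => e e0.
  have [n0 Hn] := cu p e Sp e0.
  exists ([set z | exists2 n, (n0 <=
    n)%N & u n = z], [set z | exists2 n, (n0 <= n)%N & u n = z]).
    split; exists n0 => // n /= nn; by exists n.
  move=> [_ _] [/= [n nn <-] [m mm <-]].
  by rewrite subr0 ger0_norm ?sqrtr_ge0 // Hn.
exists x => p e Sp e0.
have Pp : [set (bar_seminorm p : E ->
  R) | p in S_ A] (bar_seminorm p) by exists p.
have [h _] := @hilbert_determined R A E (u @ \oo) x _.
have /cvg0_lt/(_ e e0) := h ux _ Pp.
case=> n0 _ Hn; exists n0 => n nn.
by have := Hn n nn; rewrite /= ger0_norm ?sqrtr_ge0.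
Qed.

End hilbert_topology.

(** * Compact operators *)

Section compacts.
Context (R : realType) (A : locallyCStarType R) (E : hilbertModType A).
Implicit Types (x y z : E) (T S F : adjointable E) (p q : A -> R).
Local Notation K := (compact_operators E).

Lemma finite_rank_theta (c : R[i]) x y : finite_rank (c *: theta x y).
Proof.
by exists 1%N, (fun=> c), (fun=> x), (fun=> y); rewrite big_ord1.
Qed.

Lemma finite_rank0 : finite_rank (0 : adjointable E).
Proof.
by exists 0%N, (fun=> 0), (fun=> 0), (fun=> 0); rewrite big_ord0.
Qed.

Lemma finite_rankD F S : finite_rank F -> finite_rank S -> finite_rank (F + S).
Proof.
move=> [n [c [x [y ->]]]] [m [d [z [w ->]]]].
pose j (X : Type) (f : 'I_n -> X) (g : 'I_m -> X) (i : 'I_(n + m)) :=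
  match fintype.split i with inl k => f k | inr k => g k end.
exists (n + m)%N, (j _ c d), (j _ x z), (j _ y w).
rewrite big_split_ord /=; congr (_ + _); apply: eq_bigr => i _.
  by rewrite /j (unsplitK (inl i)).
by rewrite /j (unsplitK (inr i)).
Qed.

Lemma finite_rank_ind (P : adjointable E -> Prop) : P 0 ->
  (forall T S, P T -> P S -> P (T + S)) ->
  (forall c x y, P (c *: theta x y)) -> forall F, finite_rank F -> P F.
Proof. by move=> P0 PD PT _ [n [c [x [y ->]]]]; apply: big_ind. Qed.

Lemma finite_rankZ (c : R[i]) F : finite_rank F -> finite_rank (c *: F).
Proof.
move: F; apply: finite_rank_ind => [|T S hT hS|d x y].
- by rewrite scaler0; exact: finite_rank0.
- by rewrite scalerDr; exact: finite_rankD.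
- by rewrite scalerA; exact: finite_rank_theta.
Qed.

Lemma theta_mull T x y : T ** theta x y = theta (T x) y.
Proof. by apply: adjointable_eq => z /=; rewrite adj_ract. Qed.

Lemma theta_star x y : astar (theta x y) = theta y x.
Proof. by apply: adjoint_uniq; exact: thetaP. Qed.

Lemma finite_rank_mull T F : finite_rank F -> finite_rank (T ** F).
Proof.
move: F; apply: finite_rank_ind => [|F S hF hS|d x y].
- by rewrite amulr0; exact: finite_rank0.
- by rewrite amulDr; exact: finite_rankD.
- by rewrite amulZr theta_mull; exact: finite_rank_theta.
Qed.

Lemma finite_rank_star F : finite_rank F -> finite_rank (astar F).
Proof.
move: F; apply: finite_rank_ind => [|F S hF hS|d x y].
- by rewrite astar0; exact: finite_rank0.
- by rewrite astarD; exact: finite_rankD.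
- by rewrite astarZ theta_star; exact: finite_rank_theta.
Qed.

Lemma finite_rank_mulr T F : finite_rank F -> finite_rank (F ** T).
Proof.
move=> hF; rewrite -(astarK (F ** T)) astarM.
exact/finite_rank_star/finite_rank_mull/finite_rank_star.
Qed.

Lemma op_bounded_star p T c : S_ A p -> 0 <= c -> op_bounded p T c ->
  op_bounded p (astar T) c.
Proof.
move=> Sp c0 Tc.
exact (op_bounded_adjoint (S_cstar Sp) c0 (adjointP T) Tc).
Qed.

(** Boundedness is not part of [adjointable], so finiteness of the operator seminorms is carried
    separately. *)
Definition op_finite T := forall p, S_ A p ->
  exists2 c, 0 <= c & op_bounded p T c.

Lemma op_finiteD T S : op_finite T -> op_finite S -> op_finite (T + S).
Proof.
move=> hT hS p Sp; have [c c0 Tc] := hT _ Sp; have [d d0 Sd] := hS _ Sp.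
by exists (c + d); [exact: addr_ge0|exact (op_boundedD (S_cstar Sp) Tc Sd)].
Qed.

Lemma op_finiteZ (k : R[i]) T : op_finite T -> op_finite (k *: T).
Proof.
move=> hT p Sp; have [c c0 Tc] := hT _ Sp.
exists (Normc.normc k * c); first by rewrite mulr_ge0 ?normc_ge0.
exact (op_boundedZ (S_cstar Sp) _ Tc).
Qed.

Lemma finite_rank_finite F : finite_rank F -> op_finite F.
Proof.
move: F; apply: finite_rank_ind => [p Sp||d x y p Sp].
- by exists 0 => // x; rewrite mul0r (bar0 _ (S_cstar Sp)).
- exact: op_finiteD.
- exists (Normc.normc d * (bar_seminorm p x * bar_seminorm p y)).
    by rewrite !mulr_ge0 ?normc_ge0 ?sqrtr_ge0.
  exact (op_boundedZ (S_cstar Sp) d (op_bounded_theta (S_cstar Sp) x y)).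
Qed.

Lemma compactP T : K T <-> forall p (e : R), S_ A p -> 0 < e ->
  exists2 F, finite_rank F & op_bounded p (T - F) e.
Proof.
split=> [KT p e Sp e0|H U /op_nbhsP[p Sp [e e0 HU]]].
  have [|F [hF FT]] := KT [set S | op_bounded p (S - T) e].
    by apply/op_nbhsP; exists p => //; exists e.
  exists F => //; rewrite -opprB; exact (op_boundedN (S_cstar Sp) FT).
have [F hF FT] := H p e Sp e0; exists F; split => //; apply: HU.
by rewrite -opprB; exact (op_boundedN (S_cstar Sp) FT).
Qed.

Lemma finite_rank_compact F : finite_rank F -> K F.
Proof. exact: subset_closure. Qed.

Lemma compact_closed T : (forall p (e : R), S_ A p -> 0 < e ->
  exists2 S, K S & op_bounded p (T - S) e) -> K T.
Proof.
move=> H; apply/compactP => p e Sp e0.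
have e20 : 0 < e / 2 by rewrite divr_gt0.
have [S /compactP KS TS] := H p _ Sp e20; have [F hF SF] := KS p _ Sp e20.
exists F => //; rewrite [e]splitr.
by have := op_boundedD (S_cstar Sp) TS SF; rewrite addrA subrK.
Qed.

Lemma compact_finite T : K T -> op_finite T.
Proof.
move=> /compactP KT p Sp; have [F hF TF] := KT p _ Sp ltr01.
have [c c0 Fc] := finite_rank_finite hF Sp; exists (1 + c);
  first exact: addr_ge0.
by have := op_boundedD (S_cstar Sp) TF Fc; rewrite subrK.
Qed.

Lemma compactD T S : K T -> K S -> K (T + S).
Proof.
move=> /compactP KT /compactP KS; apply/compactP => p e Sp e0.
have e20 : 0 < e / 2 by rewrite divr_gt0.
have [F hF TF] := KT p _ Sp e20; have [G hG SG] := KS p _ Sp e20.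
exists (F + G); first exact: finite_rankD.
have := op_boundedD (S_cstar Sp) TF SG.
by rewrite -splitr addrACA -opprD.
Qed.

Lemma compact_mull T S : op_finite T -> K S -> K (T ** S).
Proof.
move=> hT /compactP KS; apply/compactP => p e Sp e0.
have [c c0 Tc] := hT _ Sp.
have c1 : 0 < c + 1 by rewrite ltr_wpDl.
have [F hF SF] := KS p _ Sp (divr_gt0 e0 c1).
exists (T ** F); first exact: finite_rank_mull.
rewrite -amulBr; apply: (op_boundedW _ (op_boundedM c0 Tc SF)).
by rewrite mulrCA ler_piMr ?(ltW e0) // ler_pdivrMr // mul1r lerDl.
Qed.

Lemma compact_star T : K T -> K (astar T).
Proof.
move=> /compactP KT; apply/compactP => p e Sp e0.
have [F hF TF] := KT p _ Sp e0; exists (astar F); first exact: finite_rank_star.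
by rewrite -astarB; apply: op_bounded_star => //; exact: ltW.
Qed.

Lemma compactM T S : K T -> K S -> K (T ** S).
Proof. by move=> /compact_finite; exact: compact_mull. Qed.

Lemma compactZ (k : R[i]) T : K T -> K (k *: T).
Proof.
move=> KT; have -> : k *: T = (k *: adj_id E) ** T by exact: adjointable_eq.
apply: compact_mull => //; apply: op_finiteZ => p Sp; exists 1 => // x.
by rewrite mul1r.
Qed.

Lemma compactN T : K T -> K (- T).
Proof. by rewrite -scaleN1r; exact: compactZ. Qed.

Lemma compactB T S : K T -> K S -> K (T - S).
Proof. by move=> KT /compactN; exact: compactD. Qed.

End compacts.

Lemma cvg0_small (R : realType) (T : Type) (F : set_system T) (f : T ->
  R) (e : R) :
  f x @[x --> F] --> (0 : R) -> 0 < e -> F [set x | `|f x| < e].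
Proof.
move=> fF e0; apply: (fF [set y | `|y| < e]).
have /cvg0_lt : id y @[y --> (0 : R)] --> (0 : R) by exact: cvg_id.
exact.
Qed.

(** * From an approximate unit to generators *)

Section countable_generation.
Context (R : realType) (A : locallyCStarType R) (E : hilbertModType A).
Implicit Types (x y z : E) (T S F : adjointable E) (p q : A -> R).
Local Notation K := (compact_operators E).

Lemma ractBl x y (a : A) : ract (x - y) a = ract x a - ract y a.
Proof. by rewrite ractDl -scaleN1r ractZl scaleN1r. Qed.

Lemma op_norm_compactP p T : S_ A p -> K T -> op_bounded p T (op_norm p T).
Proof.
by move=> Sp KT; have [c c0 Tc] := compact_finite KT Sp;
  exact (op_normP (S_cstar Sp) c0 Tc).
Qed.

(** Approximate units are tested on continuous C*-seminorms on K(E); these are the ones that reach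
    the vectors of E. Restricting to K(E) ensures that the operator seminorms are finite. *)
Lemma op_norm_seminorm p : S_ A p ->
  continuous_cstar_seminorms_on K (op_norm p : adjointable E -> R).
Proof.
move=> Sp; have hp := S_cstar Sp;
  have n0 (T : adjointable E) := op_norm_ge0 hp T.
have nP := op_norm_compactP Sp.
have nD T S : K T -> K S -> op_norm p (T + S) <= op_norm p T + op_norm p S.
  move=> KT KS; apply: op_norm_le => //; first exact: addr_ge0.
  exact (op_boundedD hp (nP _ KT) (nP _ KS)).
have nN T : K T -> op_norm p (- T) <= op_norm p T.
  move=> KT; apply: op_norm_le => //; exact (op_boundedN hp (nP _ KT)).
split; first split.
- by move=> T _; exact: n0.
- exact: nD.
- have nZ k T : K T -> op_norm p (k *: T) <= Normc.normc k * op_norm p T.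
    move=> KT; apply: op_norm_le => //; first by rewrite mulr_ge0 ?normc_ge0.
    exact (op_boundedZ hp _ (nP _ KT)).
  move=> k T KT; apply/eqP; rewrite eq_le nZ //=.
  have [->|k0] := eqVneq k 0; first by rewrite Normc.normc0 mul0r.
  have nk0 : 0 < Normc.normc k.
    rewrite lt0r normc_ge0 andbT; apply/eqP => /Normc.eq0_normc kz.
    by rewrite kz eqxx in k0.
  have := nZ k^-1 (k *: T) (compactZ KT).
  by rewrite scalerA mulVf // scale1r Normc.normcV ler_pdivlMl.
- move=> T S KT KS; apply: op_norm_le => //; first exact: mulr_ge0.
  exact (op_boundedM (n0 T) (nP _ KT) (nP _ KS)).
- move=> T KT; apply/eqP; rewrite eq_le; apply/andP; split.
    apply: op_norm_le => //; first exact: sqr_ge0.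
    rewrite expr2; apply: op_boundedM; [exact: n0| |exact: nP].
    by apply: op_bounded_star => //; exact: nP.
  have KTT : K (astar T ** T) by apply: compactM => //; exact: compact_star.
  rewrite -(sqr_sqrtr (n0 (astar T ** T))) lerXn2r ?nnegrE ?sqrtr_ge0 //.
  apply: (op_norm_le hp (sqrtr_ge0 _)).
  move=> x; rewrite -ler_sqr ?nnegrE ?mulr_ge0 ?sqrtr_ge0 // exprMn.
  rewrite (sqr_sqrtr (n0 _)) (bar_sqr hp (T x)) adjointP;
    apply: le_trans (inner_bound hp _ _) _.
  rewrite [bar_seminorm p x ^+ 2]expr2 mulrCA ler_wpM2l ?sqrtr_ge0 //.
  exact (nP _ KTT x).
- apply/subspace_continuousP => T KT; apply/cvgrPdist_lt => e e0.
  apply/op_nbhsP; exists p => //; exists (e / 2); first by rewrite divr_gt0.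
  move=> S ST KS; apply: (@le_lt_trans _ _ (e / 2)); last first.
    by rewrite ltr_pdivrMr // mulr_natr mulr2n ltrDl.
  have h : op_norm p (S - T) <= e / 2 by apply: op_norm_le => //;
    rewrite ltW // divr_gt0.
  have h' : op_norm p (T - S) <= e / 2.
    by apply: le_trans h; rewrite -opprB; apply: nN; exact: compactB.
  have a1 : op_norm p T <= e / 2 + op_norm p S.
    have := nD _ _ (compactB KT KS) KS; rewrite subrK => /le_trans; apply.
    by rewrite lerD2r.
  have a2 : op_norm p S <= e / 2 + op_norm p T.
    have := nD _ _ (compactB KS KT) KT; rewrite subrK => /le_trans; apply.
    by rewrite lerD2r.
  by rewrite ler_norml lerNl opprB !lerBlDr a1 a2.
Qed.

(** For a = <y, y>, the square of the right side is p(a^3). The C*-identity gives p(a)^4 = p(a^4) <=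
    p(a^3) p(a), and p(a) cancels. *)
Lemma bar_cube p y : S_ A p ->
  bar_seminorm p y ^+ 3 <= bar_seminorm p (ract y (inner y y)).
Proof.
move=> Sp; have hp := S_cstar Sp.
set a := inner y y; set t := bar_seminorm p y.
have t0 : 0 <= t by exact: sqrtr_ge0.
have sa : astar a = a by rewrite inner_star.
have aE : p a = t ^+ 2 by rewrite /t bar_sqr.
rewrite -(@ler_sqr _ (t ^+ 3)) ?nnegrE ?exprn_ge0 ?sqrtr_ge0 // bar_sqr //.
rewrite innerMl innerM sa -exprM -/a.
have [tz|tn] := eqVneq t 0; first by rewrite tz expr0n csn_ge0.
have tp : 0 < t ^+ 2 by rewrite exprn_gt0 // lt0r tn.
have := csnM hp (a ** (a ** a)) a.
have -> : a ** (a ** a) ** a = astar (a ** a) ** (a ** a).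
  by rewrite astarM sa !amulA.
rewrite csn_star_mul // -{1}sa csn_star_mul // aE -!exprM => h.
by rewrite -(ler_pM2r tp) -exprD.
Qed.

(* With [y = T x - x] and [D = T theta - theta], one has
   [y <y, y> = D (T* y - y)]. *)
Lemma compact_unit_pointwise p (T : adjointable E) x :
  S_ A p -> K T -> op_norm p T <= 1 ->
  bar_seminorm p (T x - x) ^+ 2 <= 2 * op_norm p (T ** theta x x - theta x x).
Proof.
move=> Sp KT T1; have hp := S_cstar Sp.
set y := T x - x; set D := _ - _; set t := bar_seminorm p y.
have KD : K D.
  by apply: compactB; [apply: compactM|] => //; apply: finite_rank_compact;
     rewrite -[theta x x]scale1r; exact: finite_rank_theta.
have t0 : 0 <= t by exact: sqrtr_ge0.
have [tz|tn] := eqVneq t 0; first by rewrite tz expr0n mulr_ge0 // op_norm_ge0.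
have tp : 0 < t by rewrite lt0r tn.
have E1 : ract y (inner y y) = D (astar T y - y).
  rewrite /D /= adj_ract scaleN1r -ractBl.
  by rewrite innerB -adjointP -innerBl.
rewrite -(ler_pM2r tp) -exprSr; apply: le_trans (bar_cube y Sp) _.
rewrite E1; apply: le_trans (op_norm_compactP Sp KD _) _.
rewrite [2 * _]mulrC -mulrA ler_wpM2l ?op_norm_ge0 //.
(* The factor 2 bounds [astar T y - y], since [astar T] is a contraction too. *)
apply: le_trans (barB hp _ _) _; rewrite mulr_natl mulr2n lerD //.
have := op_bounded_star Sp (op_norm_ge0 hp T) (op_norm_compactP Sp KT).
by move=> /(_ y)/le_trans; apply; rewrite ler_piMl.
Qed.

Lemma closed_submodule_generating (G M : set E) :
  closed_submodule M -> G `<=` M -> generated_closed_submodule G `<=` M.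
Proof. by move=> cM GM x; apply. Qed.

Lemma finite_rank_range F : finite_rank F -> exists2 X : set E, countable X &
  forall M : set E, closed_submodule M -> X `<=` M -> forall z, M (F z).
Proof.
move=> [n [c [x [y ->]]]]; exists (range x).
  exact/finite_set_countable/finite_image.
move=> M [_ M0 MD MZ MA] XM z.
have : forall s : seq 'I_n, M ((\sum_(i <- s) c i *: theta (x i) (y i)) z).
  elim=> [|i s IH]; first by rewrite big_nil.
  rewrite big_cons; apply: MD => //; apply: MZ; apply: MA; apply: XM.
  by exists i.
exact.
Qed.

Lemma countable_unit_generated : frechet A ->
  has_countable_approximate_unit K -> countably_generated E.
Proof.
move=> /frechet_cofinal[q [Sq qle qC]] [I [le [e [[[i0] lerefl _ _] cI [Ke _ e1
  ecvg]]]]].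
have H (k : I * nat) : exists X : set E, countable X /\ exists F,
    op_bounded (q k.2) (e k.1 - F) (k.2.+1%:R^-1) /\
    forall M : set E, closed_submodule M -> X `<=` M -> forall z, M (F z).
  have /compactP/(_ _ k.2.+1%:R^-1 (Sq k.2))[|F fF eF] := proj1 (Ke k.1).
    by rewrite invr_gt0.
  by have [X cX XF] := finite_rank_range fF; exists X; split => //; exists F.
have [X XP] := choice H.
exists (\bigcup_k X k).
  apply: bigcup_countable => [|k _]; last by case: (XP k).
  have -> : [set: I * nat] = [set: I] `*` [set: nat] by apply/seteqP; split.
  exact: countableX.
apply/seteqP; split => // x _ M [cM XM].
have [clM _ _ _ _] := cM; apply: clM => U /nbhs_bar[p Sp [d d0 HU]].
have [n1 [C pC]] := qC _ Sp.
have K0 : K (theta x x).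
  by apply: finite_rank_compact; rewrite -[theta x x]scale1r;
    exact: finite_rank_theta.
have d20 : 0 < d / 2 by rewrite divr_gt0.
(* The value that [compact_unit_pointwise] converts into the bound [d / 2] for [e i x - x]. *)
have c0 : 0 < (d / 2) ^+ 2 / 2 by rewrite divr_gt0 // exprn_gt0.
have [_ ec] := ecvg _ _ (op_norm_seminorm Sp) K0.
have [i ei] := cvg0_small ec c0.
have {}ei := ei i (lerefl i).
have hi : bar_seminorm p (e i x - x) < d / 2.
  rewrite -ltr_sqr ?nnegrE ?sqrtr_ge0 ?(ltW d20) //.
  apply: le_lt_trans (compact_unit_pointwise _ Sp (proj1 (Ke i)) _) _.
    exact: (e1 i _ (op_norm_seminorm Sp)).
  rewrite mulrC -ltr_pdivlMr //; apply: le_lt_trans ei; exact: ler_norm.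
have x1 : 0 < bar_seminorm p x + 1 by rewrite ltr_wpDl ?sqrtr_ge0.
have [n2 Hn2] := exists_inv_lt (divr_gt0 d20 x1).
(* [n1] makes [q n] dominate [p] up to a constant, and [n2] makes 1 / n.+1 small against x. The
   constant does not affect this choice, as [op_bounded_mono] removes it. *)
pose n := maxn n1 n2; have [_ [F [eF MF]]] := XP (i, n).
exists (F x); split; first by apply: MF => // y Xy; apply: XM; exists (i, n).
apply: HU.
have -> : F x - x = (e i x - x) - (e i x - F x).
  by rewrite opprB [RHS]addrC addrA subrK.
apply: le_lt_trans (barB (S_cstar Sp) _ _) _; rewrite [d]splitr.
apply: ltr_leD => //.
have pn a : p a <= `|C| * q n a.
  apply: le_trans (pC a) _; apply: (@le_trans _ _ (`|C| * q n1 a)).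
    by rewrite ler_wpM2r ?ler_norm // (csn_ge0 (S_cstar (Sq _))).
  by rewrite ler_wpM2l // qle // leq_maxl.
have n0 : 0 <= n.+1%:R^-1 :> R by rewrite invr_ge0.
have := op_bounded_mono (S_cstar Sp) (S_cstar (Sq n)) pn n0 eF.
move=> /(_ x); rewrite /= scaleN1r => /le_trans; apply.
apply: (@le_trans _ _ (d / 2 / (bar_seminorm p x + 1) * bar_seminorm p x)).
  rewrite ler_wpM2r ?sqrtr_ge0 //; apply: le_trans (ltW Hn2).
  by rewrite lef_pV2 ?posrE // ler_nat ltnS leq_maxr.
by rewrite mulrAC ler_pdivrMr // ler_wpM2l ?lerDl // ltW.
Qed.

End countable_generation.

(** * Resolvents of positive operators *)

Section positive_operators.
Context (R : realType) (A : locallyCStarType R) (E : preHilbertModType A).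
Implicit Types (x y z : E) (T S a b r : adjointable E) (p q : A -> R).

(** Positivity of the quadratic form for each seminorm, with no square root and no bound on [T]. *)
Definition op_pos T := is_adjoint T T /\
  forall p, S_ A p -> forall x, posA p (inner x (T x)).

Definition op_upper T := forall p, S_ A p -> exists2 t, 0 <= t &
  forall x, posA p (t%:C *: inner x x - inner x (T x)).

Lemma posA_inner p x : S_ A p -> posA p (inner x x).
Proof. by move=> Sp; exact: (positive_posA (S_cstar Sp) (inner_ge0 x)). Qed.

Lemma is_adjointD T S : is_adjoint T T -> is_adjoint S S ->
  is_adjoint (T + S) (T + S).
Proof. by move=> sT sS x y; rewrite /= innerDl innerD sT sS. Qed.

Lemma is_adjoint_realZ (t : R) T : is_adjoint T T ->
  is_adjoint (t%:C *: T) (t%:C *: T).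
Proof. by move=> sT x y; rewrite /= inner_realZl innerZ sT. Qed.

Lemma is_adjointB T S : is_adjoint T T -> is_adjoint S S ->
  is_adjoint (T - S) (T - S).
Proof.
by move=> sT sS x y; rewrite /= !scaleN1r innerBl innerB sT sS.
Qed.

Lemma op_pos0 : op_pos 0.
Proof.
split=> [x y|p Sp x] /=; first exact: (@adj_zeroP R A E).
by rewrite inner0; exact: posA0 (S_cstar Sp).
Qed.

Lemma op_posD T S : op_pos T -> op_pos S -> op_pos (T + S).
Proof.
move=> [sT pT] [sS pS]; split; first exact: is_adjointD.
move=> p Sp x; rewrite /= innerD.
exact: (posA_add (S_cstar Sp) (pT _ Sp x) (pS _ Sp x)).
Qed.

Lemma op_posZ (t : R) T : 0 <= t -> op_pos T -> op_pos (t%:C *: T).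
Proof.
move=> t0 [sT pT]; split; first exact: is_adjoint_realZ.
by move=> p Sp x; rewrite /= innerZ; exact: (posAZ (S_cstar Sp) t0 (pT _ Sp x)).
Qed.

Lemma op_pos_theta z : op_pos (theta z z).
Proof.
split; first exact: thetaP.
move=> p Sp x; rewrite /= innerM -inner_star.
exact: (posA_star_mul (S_cstar Sp)).
Qed.

Lemma op_upper0 : op_upper 0.
Proof.
move=> p Sp; exists 0 => // x; rewrite /= inner0 scale0r subr0.
exact: posA0 (S_cstar Sp).
Qed.

Lemma op_upperD T S : op_upper T -> op_upper S -> op_upper (T + S).
Proof.
move=> uT uS p Sp; have [t t0 hT] := uT p Sp; have [s s0 hS] := uS p Sp.
exists (t + s); first exact: addr_ge0.
move=> x; have := posA_add (S_cstar Sp) (hT x) (hS x).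
by rewrite /= innerD rmorphD scalerDl opprD addrACA.
Qed.

Lemma op_upperZ (t : R) T : 0 <= t -> op_upper T -> op_upper (t%:C *: T).
Proof.
move=> t0 uT p Sp; have [s s0 hT] := uT p Sp.
exists (t * s); first exact: mulr_ge0.
move=> x; have := posAZ (S_cstar Sp) t0 (hT x).
by rewrite /= innerZ scalerBr scalerA rmorphM.
Qed.

Lemma op_upper_theta z : op_upper (theta z z).
Proof.
move=> p Sp; have hp := S_cstar Sp.
have t0 : 0 < p (inner z z) + 1 by rewrite ltr_wpDl ?csn_ge0.
exists (p (inner z z) + 1); first exact: ltW.
move=> x; rewrite /= innerM -(inner_star z x).
apply: (cauchy_schwarz_pos hp (H := adj_id E)) => // [y|].
  exact: posA_inner.
by rewrite lerDl.
Qed.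

Lemma op_pos_bounded p T (m : R) : S_ A p -> op_pos T -> 0 <= m ->
  (forall x, posA p (m%:C *: inner x x - inner x (T x))) ->
  op_bounded p T m /\ op_bounded p (m%:C *: adj_id E - T) m.
Proof.
move=> Sp [sT pT] m0 mT; have hp := S_cstar Sp; split.
  by apply: op_bounded_form => // x; exact: pT.
apply: op_bounded_form => //.
- by apply: is_adjointB => //; apply: is_adjoint_realZ.
- by move=> x; rewrite /= scaleN1r innerB innerZ; exact: mT.
move=> x; rewrite /= scaleN1r innerB innerZ opprB addrC subrK.
exact: pT.
Qed.

(** The inner square of y + a y exceeds that of y by 2 <y, a y> + <a y, a y>. This gives injectivity
    of 1 + a and measures the error of approximate solutions by their residuals. *)
Lemma bar_le_pos_add p a y : S_ A p -> op_pos a ->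
  bar_seminorm p y <= bar_seminorm p (y + a y).
Proof.
move=> Sp [sa pa]; have hp := S_cstar Sp; apply: ler_wsqrtr.
apply: (posA_le hp (posA_inner y Sp)).
have -> : inner (y + a y) (y + a y) - inner y y =
    (inner y (a y) + inner y (a y)) + inner (a y) (a y).
  rewrite innerDl !innerD (sa y y).
  by rewrite [LHS]addrC !addrA addNr add0r.
apply: (posA_add hp); last exact: posA_inner.
by apply: (posA_add hp); exact: pa.
Qed.

End positive_operators.

Section resolvent.
Context (R : realType) (A : locallyCStarType R) (E : hilbertModType A).
Implicit Types (x y z : E) (T S a b r : adjointable E) (p q : A -> R).

(** By Bernoulli (1 + 1 / m)^(m^2) >= 1 + m; this is the origin of the length m^2 of the Neumann
    sums. *)
Lemma ratio_pow_bound (m : nat) :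
  (m%:R / m.+1%:R : R) ^+ (m * m) <= m.+1%:R^-1.
Proof.
case: m => [|m]; first by rewrite expr0 invr1.
have -> : (m.+1%:R / m.+2%:R : R) = (1 + m.+1%:R^-1)^-1.
  have : 0 < m.+1%:R :> R by [].
  rewrite -[m.+2%:R]natr1; move: m.+1%:R => k k0.
  by field; rewrite !lt0r_neq0 //; lra.
rewrite exprVn lef_pV2 ?posrE ?exprn_gt0 ?addr_gt0 ?invr_gt0 //.
apply: le_trans (bernoulli_ge _ _); last by rewrite invr_ge0.
by rewrite natrM -mulrA divff // mulr1 -[m.+2%:R]natr1 addrC.
Qed.

Lemma bar_eq x y : (forall p (e : R), S_ A p -> 0 < e ->
  bar_seminorm p (x - y) <= e) ->
  x = y.
Proof.
move=> H; apply/eqP; rewrite -subr_eq0; apply/eqP/bar_separating => p Sp.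
apply/eqP; rewrite eq_le sqrtr_ge0 andbT; apply/ler_addgt0Pr => e e0.
by rewrite add0r; exact: H.
Qed.

(* With [g = (m - a) / (m + 1)] one has [1 + a = (m + 1)(1 - g)]; the Neumann
   sum of length [m^2] solves the equation up to an error [1 / (m + 1)], for
   every seminorm whose bound on [a] is below [m]. *)
Lemma pos_add_surj a x : op_pos a -> op_upper a -> exists y, y + a y = x.
Proof.
move=> pa ua.
pose c (m : nat) : R := m.+1%:R^-1.
pose g m : adjointable E := (c m)%:C *: (m%:R%:C *: adj_id E - a).
pose u m : E := (c m)%:C *: \sum_(k < m * m) iter k (g m) x.
have c0 m : 0 < c m by rewrite invr_gt0.
have gE m z : (c m)%:C *: (z + a z) = z - g m z.
  apply/eqP; rewrite eq_sym subr_eq.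
  rewrite /g /= scaleN1r -scalerDr.
  rewrite [X in _ *: X](_ : _ = m.+1%:R%:C *: z).
    by rewrite scalerA -rmorphM /= mulVf // scale1r.
  by rewrite addrACA subrr addr0 -natr1 rmorphD scalerDl rmorph1 scale1r addrC.
have uE m : u m + a (u m) = x - iter (m * m) (g m) x.
  rewrite /u adjZ -scalerDr; elim: (m * m)%N => [|k IH].
    by rewrite big_ord0 adj0 addr0 scaler0 subrr.
  rewrite big_ord_recr /= adjD addrACA scalerDr IH gE.
  by rewrite addrA subrK.
have ub p : S_ A p -> exists n0 : nat, forall m, (n0 <= m)%N ->
    bar_seminorm p (u m + a (u m) - x) <= c m * bar_seminorm p x.
  move=> Sp; have hp := S_cstar Sp; have [t t0 ta] := ua p Sp.
  exists (Num.truncn t).+1 => m tm.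
  have tm' : t <= m%:R by apply: ltW; apply: lt_le_trans (truncnS_gt _) _;
    rewrite ler_nat.
  have ma z : posA p (m%:R%:C *: inner z z - inner z (a z)).
    have -> : m%:R%:C *: inner z z - inner z (a z) =
       (t%:C *: inner z z - inner z (a z)) + (m%:R - t)%:C *: inner z z.
      by rewrite rmorphB scalerBl [RHS]addrC addrA subrK.
    apply: (posA_add hp) => //; apply: (posAZ hp); last exact: posA_inner.
    by rewrite subr_ge0.
  have [_ hb] := op_pos_bounded Sp pa (ler0n _ m) ma.
  have gb z : bar_seminorm p (g m z) <= m%:R / m.+1%:R * bar_seminorm p z.
    rewrite [g m z]/= barZr // gtr0_norm // mulrC -ler_pdivlMr // invrK.
    by rewrite mulrAC divfK //; exact: hb.
  have gi k : bar_seminorm p (iter k (g m) x) <=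
    (m%:R / m.+1%:R) ^+ k * bar_seminorm p x.
    elim: k => [|k IH]; first by rewrite mul1r.
    rewrite iterS exprS -mulrA; apply: le_trans (gb _) _.
    by rewrite ler_wpM2l // divr_ge0.
  rewrite uE addrAC subrr sub0r barN //; apply: le_trans (gi _) _.
  by rewrite ler_wpM2r ?sqrtr_ge0 // ratio_pow_bound.
have cs p (e : R) : S_ A p -> 0 < e -> exists n0, forall m, (n0 <= m)%N ->
    bar_seminorm p (u m + a (u m) - x) <= e.
  move=> Sp e0; have [n0 Hn] := ub p Sp.
  have b1 : 0 < bar_seminorm p x + 1 by rewrite ltr_wpDl ?sqrtr_ge0.
  have [n1 Hn1] := exists_inv_lt (divr_gt0 e0 b1).
  exists (maxn n0 n1) => m; rewrite geq_max => /andP[m0 m1].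
  apply: le_trans (Hn _ m0) _.
  apply: (@le_trans _ _ (e / (bar_seminorm p x + 1) * bar_seminorm p x)).
    rewrite ler_wpM2r ?sqrtr_ge0 //; apply: le_trans (ltW Hn1).
    by rewrite lef_pV2 ?posrE // ler_nat.
  by rewrite mulrAC ler_pdivrMr // ler_wpM2l ?lerDl // ltW.
(* Two approximate solutions are as close as the sum of their residuals. So the [u m] form a Cauchy
   sequence, although the series changes with m. *)
have dist p y z : S_ A p -> bar_seminorm p (y - z) <=
    bar_seminorm p (y + a y - x) + bar_seminorm p (z + a z - x).
  move=> Sp; apply: le_trans (bar_le_pos_add _ Sp pa) _.
  have -> : y - z + a (y - z) = (y + a y - x) - (z + a z - x).
    by rewrite adjB addrACA -opprD opprB addrA subrK.
  exact: barB (S_cstar Sp) _ _.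
have [y uy] : exists y, forall p (e : R), S_ A p -> 0 < e ->
  exists n0, forall n,
     (n0 <= n)%N -> bar_seminorm p (u n - y) < e.
  apply: hilbert_seq_complete => p e Sp e0.
  have e30 : 0 < e / 3 by rewrite divr_gt0.
  have [n0 Hn] := cs p _ Sp e30; exists n0 => n m nn nm.
  apply: le_lt_trans (dist _ _ _ Sp) _.
  by have := Hn _ nn; have := Hn _ nm; lra.
exists y; apply: bar_eq => p e Sp e0; have hp := S_cstar Sp.
have [t t0 ta] := ua p Sp.
have [ab _] := op_pos_bounded Sp pa t0 ta.
have k0 : 0 < e / 2 / (1 + t) by rewrite !divr_gt0 // ltr_wpDr.
have [n0 Hn0] := uy p _ Sp k0.
have [n1 Hn1] := cs p (e / 2) Sp (divr_gt0 e0 (ltr0n _ 2)).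
pose n := maxn n0 n1.
have -> : y + a y - x = (u n + a (u n) - x) - ((u n - y) + a (u n - y)).
  by rewrite adjB [u n - y + _]addrACA -opprD opprB [RHS]addrC addrA subrK.
apply: le_trans (barB hp _ _) _; rewrite [e]splitr.
apply: lerD; first by apply: Hn1; exact: leq_maxr.
apply: le_trans (barD hp _ _) _.
apply: (@le_trans _ _ ((1 + t) * bar_seminorm p (u n - y))).
  by rewrite mulrDl mul1r lerD2l; exact: ab.
rewrite mulrC -ler_pdivlMr ?ltr_wpDr //; apply/ltW/Hn0; exact: leq_maxl.
Qed.

Lemma resolvent_exists a : op_pos a -> op_upper a -> exists r : adjointable E,
  [/\ is_adjoint r r, forall x, r x + a (r x) = x & forall y, r (y + a y) = y].
Proof.
move=> pa ua; have [r rE] := choice (fun x => pos_add_surj x pa ua).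
have inj y z : y + a y = z + a z -> y = z.
  move=> yz; apply: bar_eq => p e Sp e0.
  apply: le_trans (bar_le_pos_add _ Sp pa) _.
  have -> : y - z + a (y - z) = 0.
    by rewrite adjB addrACA -opprD yz subrr.
  by rewrite (bar0 _ (S_cstar Sp)) ltW.
have [sa _] := pa.
have sr : is_adjoint r r.
  move=> x y; rewrite -{2}(rE x) -{1}(rE y) innerDl innerD.
  by rewrite -sa.
exists (mk_adjointable sr); split => //= y.
by apply: inj; rewrite rE.
Qed.

End resolvent.

Section resolvent_theory.
Context (R : realType) (A : locallyCStarType R) (E : hilbertModType A).
Implicit Types (x y z : E) (T S a b r : adjointable E) (p q : A -> R).

Definition is_resolvent a r := [/\ is_adjoint r r,
  forall x, r x + a (r x) = x & forall y, r (y + a y) = y].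

Lemma resolvent_pos a r : op_pos a -> is_resolvent a r -> op_pos r.
Proof.
move=> [sa pa] [sr rE _]; split=> // p Sp x; have hp := S_cstar Sp.
rewrite -{1}(rE x) innerDl sa; apply: (posA_add hp); first exact: posA_inner.
exact: pa.
Qed.

Lemma resolvent_le1 a r p x : S_ A p -> op_pos a -> is_resolvent a r ->
  posA p (inner x x - inner x (r x)).
Proof.
move=> Sp [sa pa] [sr rE _]; have hp := S_cstar Sp.
have -> : inner x x - inner x (r x) = inner (r x + a (r x)) (a (r x)).
  by rewrite -innerB rE -[X in X - _](rE x) [_ + a _]addrC addrK.
rewrite innerDl; apply: (posA_add hp); last exact: posA_inner.
exact: pa.
Qed.

Lemma resolvent_bounded a r p : S_ A p -> op_pos a -> is_resolvent a r ->
  op_bounded p r 1.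
Proof.
move=> Sp pa ra; apply: (proj1 (op_pos_bounded Sp (resolvent_pos pa ra) ler01
  _)).
by move=> x; rewrite scale1r; exact: resolvent_le1 ra.
Qed.

(* With [d = b - a] and [z = s x], the resolvent identity reads
   [(r - s) x = r (d z)]. *)
Lemma resolvent_antitone a b r s : op_pos a -> op_pos (b - a) ->
  is_resolvent a r -> is_resolvent b s -> op_pos (r - s).
Proof.
move=> pa [sd pd] ra [ss sE _]; have [sr rE rK] := ra.
split=> [|p Sp x]; first exact: is_adjointB.
have hp := S_cstar Sp; pose z := s x; pose d := b - a.
have xE : x = (z + a z) + d z.
  by rewrite /d /= scaleN1r -addrA [a z + _]addrC subrK sE.
have rx : r x = z + r (d z) by rewrite {1}xE adjD rK.
have -> : (r - s) x = r (d z) by rewrite /= scaleN1r rx addrC addKr.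
rewrite -sr rx innerDl; apply: (posA_add hp); first exact: pd.
by rewrite sr; exact: (proj2 (resolvent_pos pa ra)).
Qed.

(** For y = r x, the element g = <x, y> = <y, y> + <y, a y> is self-adjoint. From a >= m theta x x
    follows m g^2 <= <y, a y> <= g, so p(g) <= 1 / m, while <y, y> <= g. *)
Lemma bar_resolvent_small a r p x (m : R) : S_ A p -> 0 < m -> op_pos a ->
  op_pos (a - m%:C *: theta x x) -> is_resolvent a r ->
  bar_seminorm p (r x) ^+ 2 <= m^-1.
Proof.
move=> Sp m0 [sa pa] [_ pd] [sr rE _]; have hp := S_cstar Sp.
pose y := r x; pose g := inner y y + inner y (a y).
have gE : inner x y = g by rewrite -{1}(rE x) innerDl sa.
have sg : astar g = g by rewrite /g astarD !inner_star sa.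
have yg : inner y x = g by rewrite -inner_star gE.
have h : posA p (g - m%:C *: (astar g ** g)).
  have -> : g - m%:C *: (astar g ** g) =
    inner y y + inner y ((a - m%:C *: theta x x) y).
    by rewrite /= scaleN1r innerB innerZ innerM gE yg sg addrA.
  by apply: (posA_add hp); [exact: posA_inner|exact: pd].
have p1 := posA_le hp (posAZ hp (ltW m0) (posA_star_mul hp g)) h.
have pg : p g <= m^-1.
  move: p1; rewrite csnZr // csn_star_mul // gtr0_norm //.
  have := csn_ge0 hp g; rewrite -[m^-1]mul1r ler_pdivlMr //.
  rewrite le_eqVlt => /predU1P[<-|g0]; first by rewrite mul0r ler01.
  by rewrite expr2 mulrA ger_pMl // mulrC.
apply: le_trans pg; rewrite bar_sqr //.
apply: (posA_le hp (posA_inner _ Sp)).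
by rewrite /g addrC addKr; exact: pa.
Qed.

End resolvent_theory.

Section adjointable_ncring.
Context (R : realType) (A : locallyCStarType R) (E : preHilbertModType A).

#[global] Instance adj_ncring_ops : @Ncring.Ring_ops (adjointable E) 0 (adj_id
  E)
  +%R (@amul R (adjointable E)) (fun T S => T - S) -%R eq := {}.

#[global] Instance adj_ncring : @Ncring.Ring (adjointable E) 0 (adj_id E)
  +%R (@amul R (adjointable E)) (fun T S => T - S) -%R eq adj_ncring_ops.
Proof.
constructor.
- exact: RelationClasses.eq_equivalence.
- by move=> x x' -> y y' ->.
- by move=> x x' -> y y' ->.
- by move=> x x' -> y y' ->.
- by move=> x x' -> .
- exact: add0r.
- exact: addrC.
- exact: addrA.
- by move=> T; exact: adjointable_eq.
- by move=> T; exact: adjointable_eq.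
- exact: amulA.
- exact: amulDl.
- by move=> x y z; exact: amulDr.
- by [].
- exact: addrN.
Qed.

End adjointable_ncring.

(** * Square roots of compact operators *)

Section compact_square_root.
Context (R : realType) (A : locallyCStarType R) (E : hilbertModType A).
Implicit Types (x y z : E) (T S D : adjointable E) (p q : A -> R).
Local Notation K := (compact_operators E).
Local Notation id := (adj_id E).

Lemma is_adjoint_amul T S : is_adjoint T T -> is_adjoint S S ->
  T ** S = S ** T ->
  is_adjoint (T ** S) (T ** S).
Proof.
by move=> sT sS TS x y; rewrite {1}TS /= sS sT.
Qed.

Lemma amul1l T : id ** T = T. Proof. exact: adjointable_eq. Qed.
Lemma amul1r T : T ** id = T. Proof. exact: adjointable_eq. Qed.

(** The limit is taken pointwise. Only self-adjointness is passed to the limit, since a map with an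
    adjoint is automatically linear over [A]. *)
Lemma hilbert_op_limit (y : nat -> adjointable E) (d : nat -> R) :
  (forall n, is_adjoint (y n) (y n)) ->
  (forall p n m, S_ A p -> (n <= m)%N -> op_bounded p (y m - y n) (d n)) ->
  (forall e, 0 < e -> exists n0, forall n, (n0 <= n)%N -> d n <= e) ->
  exists L : adjointable E, is_adjoint L L /\
    forall p n, S_ A p -> op_bounded p (L - y n) (d n).
Proof.
move=> sy yd d0.
have yB m n x : (y m - y n) x = y m x - y n x by rewrite /= scaleN1r.
have small p x (e : R) : 0 < e -> S_ A p -> exists n0, forall n, (n0 <= n)%N ->
    d n * bar_seminorm p x <= e.
  move=> e0 Sp; have b1 : 0 < bar_seminorm p x + 1 by rewrite ltr_wpDl
    ?sqrtr_ge0.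
  have [n0 Hn] := d0 _ (divr_gt0 e0 b1); exists n0 => n /Hn dn.
  apply: (@le_trans _ _ (e / (bar_seminorm p x + 1) * bar_seminorm p x)).
    by rewrite ler_wpM2r ?sqrtr_ge0.
  by rewrite mulrAC ler_pdivrMr // ler_wpM2l ?lerDl // ltW.
have /choice[L LP] : forall x, exists l, forall p (e : R), S_ A p -> 0 < e ->
    exists n0, forall n, (n0 <= n)%N -> bar_seminorm p (y n x - l) < e.
  move=> x; apply: hilbert_seq_complete => p e Sp e0.
  have [n0 Hn] := small p x (e / 2) (divr_gt0 e0 (ltr0n _ 2)) Sp.
  have e2 : e / 2 < e by rewrite ltr_pdivrMr // mulr_natr mulr2n ltrDl.
  exists n0 => n m nn nm; apply: le_lt_trans e2.
  case: (leqP n m) => nm'.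
    rewrite -(barN (S_cstar Sp)) opprB -yB.
    exact: le_trans (yd p n m Sp nm' x) (Hn _ nn).
  by rewrite -yB; exact: le_trans (yd p m n Sp (ltnW nm') x) (Hn _ nm).
have Ld p n x : S_ A p -> bar_seminorm p (L x - y n x) <=
  d n * bar_seminorm p x.
  move=> Sp; have hp := S_cstar Sp; apply/ler_addgt0Pr => e e0.
  have [n0 Hn] := LP x p e Sp e0; pose m := maxn n n0.
  have -> : L x - y n x = (y m - y n) x - (y m x - L x).
    by rewrite yB opprB [RHS]addrC addrA subrK.
  apply: le_trans (barB hp _ _) _; apply: lerD; first by apply: yd => //;
    exact: leq_maxl.
  by apply/ltW/Hn; exact: leq_maxr.
have sL : is_adjoint L L.
  move=> x z; apply/eqP; rewrite -subr_eq0; apply/eqP/S_separating => p Sp.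
  have hp := S_cstar Sp.
  apply/eqP; rewrite eq_le csn_ge0 // andbT; apply/ler_addgt0Pr => e e0.
  rewrite add0r.
  have k0 : 0 < e / 2 / (bar_seminorm p x + bar_seminorm p z + 1).
    by rewrite !divr_gt0 // ltr_wpDl ?addr_ge0 ?sqrtr_ge0.
  have [n1 H1] := LP x p _ Sp k0; have [n2 H2] := LP z p _ Sp k0.
  pose n := maxn n1 n2.
  have -> : inner (L x) z - inner x (L z) =
      inner x (y n z - L z) - inner (y n x - L x) z.
    by rewrite innerB innerBl sy opprB [RHS]addrC addrA subrK.
  apply: le_trans (csnB hp _ _) _; rewrite [e]splitr.
  have bz : forall s t u : R, 0 <= s -> 0 <= u -> t < e / 2 / (s + u + 1) ->
    0 <= t ->
      s * t <= e / 2.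
    move=> s t u s0 u0; rewrite ltr_pdivlMr ?ltr_wpDl ?addr_ge0 // => h t0.
    by apply: le_trans (ltW h); rewrite mulrC ler_wpM2l // -addrA lerDl
      addr_ge0.
  apply: lerD.
    apply: le_trans (inner_bound hp _ _) _.
    apply: (bz _ _ (bar_seminorm p z)); rewrite ?sqrtr_ge0 //.
    by apply: H2; exact: leq_maxr.
  apply: le_trans (inner_bound hp _ _) _; rewrite mulrC.
  apply: (bz _ _ (bar_seminorm p x));
    rewrite ?sqrtr_ge0 // [bar_seminorm p z + _]addrC.
  by apply: H1; exact: leq_maxl.
exists (mk_adjointable sL); split => // p n Sp x.
by rewrite /= scaleN1r; exact: Ld.
Qed.

Lemma op_eq T S : (forall p (e : R), S_ A p -> 0 < e ->
  op_bounded p (T - S) e) -> T = S.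
Proof.
move=> H; apply: adjointable_eq => x; apply: bar_eq => p e Sp e0.
have b1 : 0 < bar_seminorm p x + 1 by rewrite ltr_wpDl ?sqrtr_ge0.
have := H p _ Sp (divr_gt0 e0 b1) x; rewrite /= scaleN1r => /le_trans; apply.
by rewrite mulrAC ler_pdivrMr // ler_wpM2l ?lerDl // ltW.
Qed.

(* The iterates [y n] approximate [1 - sqrt D]; the operators [maj n - y n],
   unlike [1 - y n], are compact. *)
Lemma compact_positive D : K D -> is_adjoint D D ->
  (forall p, S_ A p -> op_bounded p (id - D) 1) -> positive_in K D.
Proof.
move=> KD sD D1; pose x := id - D.
pose y : nat -> adjointable E := sqrt_iter (@amul R (adjointable E)) x.
have sx : is_adjoint x x by apply: is_adjointB.
have yy m n : y m ** y n = y n ** y m.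
  exact: (sqrt_iter_swap (@amulA R _) (@amulDl R _) (@amulDr R _) (@amulZl R _)
    (@amulZr R _)).
have sy n : is_adjoint (y n) (y n).
  elim: n => [|n IH]; first exact: (@adj_zeroP R A E).
  by apply: is_adjoint_realZ; apply: is_adjointD => //; exact: is_adjoint_amul.
have B0 p : S_ A p -> op_bounded p (0 : adjointable E) 0.
  by move=> Sp z; rewrite mul0r (bar0 _ (S_cstar Sp)).
have BZ p : S_ A p -> forall (t : R) (u : adjointable E) c, 0 <= t ->
    op_bounded p u c -> op_bounded p (t%:C *: u) (t * c).
  move=> Sp t u c t0 uc; rewrite -{2}(ger0_norm t0) -normc_realC.
  exact (op_boundedZ (S_cstar Sp) _ uc).
have yB p n m : S_ A p -> (n <= m)%N ->
    op_bounded p (y m - y n) (maj R m - maj R n).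
  move=> Sp nm; refine (sqrt_iter_sub (@amulA R _) (@amulDl R _) (@amulDr R _)
    (@amulZl R _) (@amulZr R _) (B := op_bounded p) _ _ _ _ _ nm).
  - exact: B0.
  - by move=> u v c d uc vd; exact (op_boundedD (S_cstar Sp) uc vd).
  - exact: BZ.
  - by move=> u v c d c0 uc vd; exact (op_boundedM c0 uc vd).
  - exact: D1.
have ybd p n : S_ A p -> op_bounded p (y n) 1.
  move=> Sp; have := yB p 0%N n Sp (leq0n n); rewrite /y /= !subr0.
  exact/op_boundedW/maj_le1.
have [L [sL Ld]] : exists L : adjointable E, is_adjoint L L /\
    forall p n, S_ A p -> op_bounded p (L - y n) (1 - maj R n).
  apply: hilbert_op_limit => // [p n m Sp nm|e e0].
    by apply: op_boundedW (yB p n m Sp nm); rewrite lerD2r maj_le1.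
  by have [n0 Hn] := maj_step_small e0; exists n0 => n /Hn[].
have L1 p : S_ A p -> op_bounded p L 2.
  move=> Sp; have := op_boundedD (S_cstar Sp) (Ld p 0%N Sp) (ybd p 0%N Sp).
  by rewrite subrK /= subr0.
have id1 p : S_ A p -> op_bounded p id 1 by move=> Sp z; rewrite mul1r.
pose s n := id - y n; pose S := id - L.
have Ky n : K ((maj R n)%:C *: id - y n).
  elim: n => [|n IH].
    rewrite /y /= scale0r subr0; apply: finite_rank_compact;
      exact: finite_rank0.
  set k := (maj R n)%:C *: id - y n in IH.
  (* With m = maj n and y = m - k, the difference of 1 + m^2 and x + y^2 is D + 2 m k - k^2, as 1 -
     x = D. The scalar parts cancel, so compactness propagates. *)
  have -> : (maj R n.+1)%:C *: id - y n.+1 =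
    (2^-1)%:C *: (D + ((maj R n)%:C *: k + (maj R n)%:C *: k - k ** k)).
    have yE : y n = (maj R n)%:C *: id - k by rewrite /k opprB addrC subrK.
    clearbody k.
    rewrite [y n.+1]/(_ *: (x + y n ** y n)) yE majS mulrC.
    rewrite rmorphM -scalerA -scalerBr; congr (_ *: _).
    rewrite amulBl !amulBr !amulZl !amulZr !amul1l !amul1r rmorphD rmorph1.
    rewrite scalerDl scale1r /x.
    rewrite scalerA -rmorphM -expr2.
    set m2 := _ *: id; set mk := _ *: k; clearbody mk m2; nc_ring.
  apply: compactZ; apply: compactD => //; apply: compactB; last exact: compactM.
  by apply: compactD; exact: compactZ.
have KS : K S.
  apply: compact_closed => p e Sp e0.
  have [n0 /(_ n0 (leqnn n0)) [_ Hn]] :=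
    maj_step_small (divr_gt0 e0 (ltr0n _ 2)).
  exists ((maj R n0)%:C *: id - y n0); first exact: Ky.
  have -> : S - ((maj R n0)%:C *: id - y n0) =
      (1 - maj R n0)%:C *: id - (L - y n0).
    by rewrite rmorphB rmorph1 scalerBl scale1r /S; nc_ring.
  apply: op_boundedW (op_boundedB (S_cstar Sp) (BZ _ Sp _ _ _ _ (id1 _ Sp)) (Ld
    p n0 Sp)).
    by rewrite mulr1; lra.
  by rewrite subr_ge0 maj_le1.
exists S => //.
have sS : is_adjoint S S by apply: is_adjointB.
have -> : astar S = S by exact: adjoint_uniq.
apply/esym/op_eq => p e Sp e0; have hp := S_cstar Sp.
(* The three error terms below carry the factors 3, 2 and 2, with total less than 10. *)
have [n0 /(_ n0 (leqnn n0)) [Hs Hn]] :=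
  maj_step_small (divr_gt0 e0 (ltr0n _ 10)).
have SE : S ** S - D = (S ** (S - s n0) + (S - s n0) ** s n0)
    + (2%:C *: (y n0.+1 - y n0)).
  have y2 : 2%:C *: y n0.+1 = x + y n0 ** y n0.
    by rewrite [y n0.+1]/(_ *: (x + y n0 ** y n0)) scalerA -rmorphM /= divff //
      scale1r.
  rewrite scalerBr y2 rmorphD rmorph1 scalerDl scale1r /S /s /x.
  move: (y n0) => v; nc_ring.
rewrite SE.
have Ss : S - s n0 = - (L - y n0).
  by rewrite /S /s; nc_ring.
have S3 : op_bounded p S 3.
  have := op_boundedB hp (id1 _ Sp) (L1 _ Sp); exact: op_boundedW.
have s2 : op_bounded p (s n0) 2.
  have := op_boundedB hp (id1 _ Sp) (ybd p n0 Sp); exact: op_boundedW.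
have Sd : op_bounded p (S - s n0) (1 - maj R n0).
  by rewrite Ss; exact (op_boundedN hp (Ld p n0 Sp)).
have d0 : 0 <= 1 - maj R n0 by rewrite subr_ge0 maj_le1.
have h1 := op_boundedM (ler0n R 3) S3 Sd.
have h2 := op_boundedM d0 Sd s2.
have h3 := BZ p Sp 2 _ _ (ler0n R 2) (yB p _ _ Sp (leqnSn n0)).
apply: op_boundedW (op_boundedD hp (op_boundedD hp h1 h2) h3).
lra.
Qed.

End compact_square_root.

(** * From generators to an approximate unit *)

Section approximate_unit_construction.
Context (R : realType) (A : locallyCStarType R) (E : hilbertModType A).
Implicit Types (x y z : E) (T S D F a b : adjointable E) (p q : A -> R).
Local Notation K := (compact_operators E).

Lemma net_filter_filter (I : Type) (le : I -> I -> Prop) :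
  directed le -> Filter (net_filter le).
Proof.
move=> [[i0] refl trans dir]; split.
- by exists i0.
- move=> U W [i Ui] [j Wj]; have [k [ik jk]] := dir i j.
  by exists k => l kl; split; [apply: Ui|apply: Wj]; apply: trans kl.
- by move=> U W UW [i Ui]; exists i => j /Ui /UW.
Qed.

Lemma directed_leq : directed (fun i j => (i <= j)%N).
Proof.
split; [by constructor; exact: 0%N|by []|by move=> i j k; exact: leq_trans|].
by move=> i j; exists (maxn i j); rewrite leq_maxl leq_maxr.
Qed.

(** Continuity at 0 puts the operators of K(E) in some ball for [q] into the unit ball of [n];
    homogeneity does the rest. *)
Lemma compact_seminorm_dominated (n : adjointable E -> R) :
  continuous_cstar_seminorms_on K n ->
  exists2 q, S_ A q & exists2 C, 0 <= C &
    forall T c, 0 <= c -> K T -> op_bounded q T c -> n T <= C * c.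
Proof.
move=> [[n_ge0 nD nZ nM nstar] ncont].
have K0 : K 0 by apply: finite_rank_compact; exact: finite_rank0.
have n0 : n 0 = 0 by rewrite -(scale0r (0 : adjointable E)) nZ // Normc.normc0
  mul0r.
have /subspace_continuousP/(_ 0 K0)/cvgrPdist_lt/(_ 1 ltr01) := ncont.
move=> /op_nbhsP[q Sq [e e0 H]]; have hq := S_cstar Sq.
have {}H S : op_bounded q (S - 0) e -> K S -> `|n S| < 1.
  move=> h KS; have : `|n 0 - n S| < 1 := H S h KS.
  by rewrite n0 sub0r normrN.
exists q => //; exists (2 / e); first by rewrite divr_ge0 // ltW.
move=> T c c0 KT Tc; apply/ler_addgt0Pr => d d0.
(* Since c may be 0, it is enlarged before dividing; the enlargement costs at most d in the
   conclusion. *)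
pose c' := c + d * e / 2; have c'0 : 0 < c' by rewrite ltr_wpDl // !divr_gt0
  ?mulr_gt0.
pose t := e / c'; have t0 : 0 < t by rewrite divr_gt0.
have Tt : op_bounded q (t%:C *: T - 0) e.
  rewrite subr0; have := op_boundedZ hq t%:C Tc;
    rewrite normc_realC gtr0_norm //.
  apply: op_boundedW; rewrite /t mulrAC ler_pdivrMr // ler_wpM2l ?(ltW e0) //.
  by rewrite lerDl !divr_ge0 ?mulr_ge0 // ltW.
have := le_lt_trans (ler_norm _) (H _ Tt (compactZ KT)).
rewrite nZ // normc_realC gtr0_norm // -ltr_pdivlMl // mulr1 => /ltW h.
apply: le_trans h _; rewrite /t invf_div /c' ler_pdivrMr //.
have -> : (2 / e * c + d) * e = 2 * c + d * e by field; rewrite lt0r_neq0.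
have : 0 <= d * e by rewrite mulr_ge0 // ltW.
lra.
Qed.

(** The powers T^(2^k) keep the operator bound 1, so the value of [n] on them, which is (n T)^(2^k),
    stays below the constant of [compact_seminorm_dominated]. This forces n T <= 1. *)
Lemma compact_seminorm_le1 (n : adjointable E -> R) T :
  continuous_cstar_seminorms_on K n -> K T -> is_adjoint T T ->
  (forall q, S_ A q -> op_bounded q T 1) -> n T <= 1.
Proof.
move=> Sn KT sT T1; have [q Sq [C C0 H]] := compact_seminorm_dominated Sn.
have [[n_ge0 _ _ _ nstar] _] := Sn.
pose pw k := iter k (fun S => S ** S) T.
have pwP k : [/\ K (pw k), is_adjoint (pw k) (pw k), op_bounded q (pw k) 1
    & n (pw k) = n T ^+ (2 ^ k)].
  elim: k => [|k [Kk sk bk nk]].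
    by split => //; exact: T1.
  split; rewrite /= -/(pw k).
  - exact: compactM.
  - exact: is_adjoint_amul.
  - by have := op_boundedM ler01 bk bk; rewrite mulr1.
  - rewrite expnS mulnC exprM -nk -nstar //.
    by congr (n (_ ** _)); apply/esym/adjoint_uniq.
apply: (@pow_le_mul _ _ _ C) => //; first exact: n_ge0.
move=> k; exists (2 ^ k)%N; first exact/ltnW/ltn_expl.
have [Kk _ bk <-] := pwP k; rewrite expr1n; exact: H.
Qed.

Variable g : nat -> E.
Hypothesis g_gen : generating_set (range g).

Definition frame_sum n : adjointable E := \sum_(k < n) theta (g k) (g k).
Definition frame_op n : adjointable E := n%:R%:C *: frame_sum n.

Lemma frame_sum_pos n : op_pos (frame_sum n).
Proof.
rewrite /frame_sum; elim/big_ind: _ => [|T S|k _].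
- exact: op_pos0.
- exact: op_posD.
- exact: op_pos_theta.
Qed.

Lemma frame_op_pos n : op_pos (frame_op n).
Proof. by apply: op_posZ => //; exact: frame_sum_pos. Qed.

Lemma frame_op_upper n : op_upper (frame_op n).
Proof.
apply: op_upperZ => //; rewrite /frame_sum; elim/big_ind: _ => [|T S|k _].
- exact: op_upper0.
- exact: op_upperD.
- exact: op_upper_theta.
Qed.

Lemma frame_op_mono m n : (m <= n)%N -> op_pos (frame_op n - frame_op m).
Proof.
move=> mn; rewrite -(subnKC mn); elim: (n - m)%N => [|k IH].
  by rewrite addn0 subrr; exact: op_pos0.
rewrite addnS; set l := (m + k)%N in IH *.
have -> : frame_op l.+1 - frame_op m = (frame_op l - frame_op m) +
    (frame_sum l + l.+1%:R%:C *: theta (g l) (g l)).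
  rewrite {1}/frame_op /frame_sum big_ord_recr /= -/(frame_sum l) scalerDr.
  rewrite -{1}natr1 rmorphD rmorph1 scalerDl scale1r -/(frame_op l).
  set u := _ *: theta _ _; clearbody u; nc_ring.
apply: op_posD => //; apply: op_posD; first exact: frame_sum_pos.
by apply: op_posZ => //; exact: op_pos_theta.
Qed.

Lemma frame_op_theta k n : (k < n)%N ->
  op_pos (frame_op n - n%:R%:C *: theta (g k) (g k)).
Proof.
move=> kn; rewrite /frame_op -scalerBr; apply: op_posZ => //.
rewrite /frame_sum (bigD1 (Ordinal kn)) //= addrAC subrr add0r.
elim/big_ind: _ => [|T S|i _].
- exact: op_pos0.
- exact: op_posD.
- exact: op_pos_theta.
Qed.

Lemma frame_op_finite_rank n : finite_rank (frame_op n).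
Proof.
apply: finite_rankZ; rewrite /frame_sum; elim/big_ind: _ => [|T S|i _].
- exact: finite_rank0.
- exact: finite_rankD.
- by rewrite -[theta _ _]scale1r; exact: finite_rank_theta.
Qed.

Variable r : nat -> adjointable E.
Hypothesis rP : forall n, is_resolvent (frame_op n) (r n).

Let e n := frame_op n ** r n.

Let eE n : e n = adj_id E - r n.
Proof.
apply: adjointable_eq => x; rewrite /= scaleN1r.
by have [_ rE _] := rP n; rewrite -{2}(rE x) [RHS]addrC addKr.
Qed.

Let r1 p n : S_ A p -> op_bounded p (r n) 1.
Proof. by move=> Sp; exact: resolvent_bounded Sp (frame_op_pos n) (rP n). Qed.

(** The vectors with this property form a submodule, closed because all [r n] are contractions;
    [bar_resolvent_small] puts the generators in it. *)
Lemma bar_frame_resolvent_cvg0 p x (d : R) : S_ A p -> 0 < d ->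
  exists n0, forall n, (n0 <= n)%N -> bar_seminorm p (r n x) < d.
Proof.
move: p d; pose M := [set x | forall p (d : R), S_ A p -> 0 < d ->
  exists n0, forall n, (n0 <= n)%N -> bar_seminorm p (r n x) < d].
suff : M x by [].
suff : generated_closed_submodule (range g) `<=` M by apply; rewrite g_gen.
have rle p n y : S_ A p -> bar_seminorm p (r n y) <= bar_seminorm p y.
  by move=> Sp; rewrite -[leRHS]mul1r; exact: r1.
apply: closed_submodule_generating; first split.
- move=> y yM p d Sp d0; have hp := S_cstar Sp.
  have d20 : 0 < d / 2 by rewrite divr_gt0.
  have [z [Mz zy]] := yM _ (bar_nbhs y Sp d20).
  have [n0 Hn] := Mz p _ Sp d20; exists n0 => n nn.
  have -> : r n y = r n z - r n (z - y) by rewrite adjB opprB addrC subrK.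
  apply: le_lt_trans (barB hp _ _) _; rewrite [d]splitr.
  by apply: ltrD; [exact: Hn|exact: le_lt_trans (rle p n _ Sp) zy].
- move=> p d Sp d0; exists 0%N => n _.
  by rewrite adj0 (bar0 _ (S_cstar Sp)).
- move=> y z My Mz p d Sp d0; have d20 : 0 < d / 2 by rewrite divr_gt0.
  have [n1 H1] := My p _ Sp d20; have [n2 H2] := Mz p _ Sp d20.
  exists (maxn n1 n2) => n; rewrite geq_max => /andP[h1 h2].
  rewrite adjD; apply: le_lt_trans (barD (S_cstar Sp) _ _) _; rewrite [d]splitr.
  by apply: ltrD; [exact: H1|exact: H2].
- move=> c y My p d Sp d0.
  have c1 : 0 < Normc.normc c + 1 by rewrite ltr_wpDl ?normc_ge0.
  have [n0 Hn] := My p _ Sp (divr_gt0 d0 c1); exists n0 => n nn.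
  rewrite adjZ (barZ (S_cstar Sp)).
  apply: (@le_lt_trans _ _ ((Normc.normc c + 1) * bar_seminorm p (r n y))).
    by rewrite ler_wpM2r ?sqrtr_ge0 // lerDl.
  by rewrite mulrC -ltr_pdivlMr //; exact: Hn.
- move=> y a My p d Sp d0; have hp := S_cstar Sp.
  have c1 : 0 < p a + 1 by rewrite ltr_wpDl ?csn_ge0.
  have [n0 Hn] := My p _ Sp (divr_gt0 d0 c1); exists n0 => n nn.
  rewrite adj_ract; apply: le_lt_trans (bar_ract hp _ _) _.
  apply: (@le_lt_trans _ _ (bar_seminorm p (r n y) * (p a + 1))).
    by rewrite ler_wpM2l ?sqrtr_ge0 // lerDl.
  by rewrite -ltr_pdivlMr //; exact: Hn.
- move=> _ [k _ <-] p d Sp d0.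
  have dd0 : 0 < d ^+ 2 by rewrite exprn_gt0.
  have [n0 Hn] := exists_inv_lt dd0.
  (* The successor makes the index positive, so that [g k] occurs in the frame and 1 / n.+1 is below
     d ^ 2. *)
  exists (maxn k n0).+1 => -[//|n] nn.
  have [kn n0n] : (k < n.+1)%N /\ (n0 <= n)%N.
    by move: nn; rewrite ltnS geq_max => /andP[].
  rewrite -ltr_sqr ?nnegrE ?sqrtr_ge0 ?(ltW d0) //.
  apply: le_lt_trans (bar_resolvent_small Sp _ (frame_op_pos _) (frame_op_theta
    kn) (rP _)) _.
    by rewrite ltr0n.
  by apply: le_lt_trans Hn; rewrite lef_pV2 ?posrE // ler_nat.
Qed.

(** Pointwise convergence becomes convergence in seminorm on finite rank operators, as [r n] maps
    theta_(x, y) to theta_(r_n x, y). Contractivity extends it to the closure. *)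
Lemma frame_resolvent_compact_cvg0 p T (d : R) : S_ A p -> K T -> 0 < d ->
  exists n0, forall n, (n0 <= n)%N -> op_bounded p (r n ** T) d.
Proof.
move=> Sp /compactP KT d0; have hp := S_cstar Sp.
have frank F : finite_rank F -> forall c : R, 0 < c ->
    exists n0, forall n, (n0 <= n)%N -> op_bounded p (r n ** F) c.
  move: F; apply: finite_rank_ind => [c c0|F S hF hS c c0|k x y c c0].
  - exists 0%N => n _ x; rewrite amulr0 /= (bar0 _ hp).
    by rewrite mulr_ge0 ?sqrtr_ge0 // ltW.
  - have c20 : 0 < c / 2 by rewrite divr_gt0.
    have [n1 H1] := hF _ c20; have [n2 H2] := hS _ c20.
    exists (maxn n1 n2) => n; rewrite geq_max => /andP[h1 h2].
    by rewrite amulDr [c]splitr; exact (op_boundedD hp (H1 _ h1) (H2 _ h2)).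
  - pose m := Normc.normc k * bar_seminorm p y + 1.
    have m0 : 0 < m by rewrite ltr_wpDl ?mulr_ge0 ?normc_ge0 ?sqrtr_ge0.
    have [n0 Hn] := bar_frame_resolvent_cvg0 x Sp (divr_gt0 c0 m0).
    exists n0 => n nn; rewrite amulZr theta_mull.
    apply: op_boundedW (op_boundedZ hp k (op_bounded_theta hp (r n x) y)).
    rewrite mulrCA; apply: (@le_trans _ _ (bar_seminorm p (r n x) * m)).
      by rewrite ler_wpM2l ?sqrtr_ge0 // lerDl.
    by rewrite -ler_pdivlMr //; apply/ltW/Hn.
have d20 : 0 < d / 2 by rewrite divr_gt0.
have [F hF TF] := KT p _ Sp d20; have [n0 Hn] := frank F hF _ d20.
exists n0 => n nn.
have -> : r n ** T = r n ** (T - F) + r n ** F by nc_ring.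
rewrite [d]splitr; apply: (op_boundedD hp) (Hn _ nn).
have := op_boundedM ler01 (r1 n Sp) TF; rewrite mul1r; exact.
Qed.

Lemma frame_approximate_unit : approximate_unit K (fun i j => (i <= j)%N) e.
Proof.
have Ke n : K (e n).
  by apply: finite_rank_compact; apply: finite_rank_mulr;
    exact: frame_op_finite_rank.
have sr n : is_adjoint (r n) (r n) by case: (rP n).
have se n : is_adjoint (e n) (e n) by rewrite eE; exact: is_adjointB.
have e_upper p n x : S_ A p -> posA p (1%:C *: inner x x - inner x (r n x)).
  by move=> Sp; rewrite scale1r; exact: resolvent_le1 (frame_op_pos n) (rP n).
have FF := net_filter_filter directed_leq.
split.
- move=> n; split => //; apply: compact_positive => // p Sp.
  by rewrite eE opprB addrC subrK; exact: r1.
- move=> i j ij; have eij : e j - e i = r i - r j by rewrite !eE; nc_ring.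
  apply: compact_positive => [||p Sp].
  + exact: compactB.
  + exact: is_adjointB.
  (* From 0 <= r i - r j <= r i <= 1, the complement of [e j - e i] also lies between 0 and 1, as
     [compact_positive] requires. *)
  have pij : op_pos (r i - r j).
    exact: resolvent_antitone (frame_op_pos i) (frame_op_mono ij) (rP i) (rP j).
  have := op_pos_bounded Sp pij ler01 _; rewrite eij scale1r; case => // x.
  have hp := S_cstar Sp.
  have -> : 1%:C *: inner x x - inner x ((r i - r j) x) =
     (1%:C *: inner x x - inner x (r i x)) + inner x (r j x).
    by rewrite /= scaleN1r innerB opprB addrA addrAC.
  apply: (posA_add hp); first exact: e_upper.
  exact: (proj2 (resolvent_pos (frame_op_pos j) (rP j))).
- move=> n p Sp; apply: (compact_seminorm_le1 Sp) => // q Sq.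
  have := op_pos_bounded Sq (resolvent_pos (frame_op_pos n) (rP n)) ler01 _.
  by rewrite eE scale1r; case => // x; exact: e_upper.
- move=> p T Sp KT; have [q Sq [C C0 H]] := compact_seminorm_dominated Sp.
  have [[p_ge0 _ _ _ _] _] := Sp.
  have C1 : 0 < C + 1 by rewrite ltr_wpDl.
  have small (f : nat -> adjointable E) : (forall n, K (f n)) ->
      (forall d : R, 0 < d -> exists n0, forall n, (n0 <= n)%N ->
        op_bounded q (f n) d) ->
      p (f i) @[i --> net_filter (fun i j => (i <= j)%N)] --> (0 : R).
    move=> Kf fd; apply/cvg0_lt => d d0.
    have [n0 Hn] := fd _ (divr_gt0 d0 C1); exists n0 => n nn /=.
    rewrite ger0_norm ?p_ge0 //.
    apply: le_lt_trans (H _ _ (ltW (divr_gt0 d0 C1)) (Kf n) (Hn _ nn)) _.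
    by rewrite mulrA ltr_pdivrMr // mulrC ltr_pM2l // ltrDl.
  split; apply: small => [n|d d0].
  + by apply: compactB => //; exact: compactM.
  + have [n0 Hn] := frame_resolvent_compact_cvg0 Sq (compact_star KT) d0.
    exists n0 => n nn.
    (* Taking adjoints turns multiplication on the right into multiplication on the left. *)
    have -> : T ** e n - T = - astar (r n ** astar T).
      by rewrite eE astarM astarK (adjoint_uniq (sr n) : astar (r n) = r n);
        nc_ring.
    apply: (op_boundedN (S_cstar Sq)); apply: op_bounded_star => //;
      first exact: ltW.
    exact: Hn.
  + by apply: compactB => //; exact: compactM.
  + have [n0 Hn] := frame_resolvent_compact_cvg0 Sq KT d0.
    exists n0 => n nn.
    have -> : e n ** T - T = - (r n ** T) by rewrite eE; nc_ring.
    apply: (op_boundedN (S_cstar Sq)); exact: Hn.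
Qed.

End approximate_unit_construction.

Lemma generated_countable_unit (R : realType) (A : locallyCStarType R)
    (E : hilbertModType A) :
  countably_generated E -> has_countable_approximate_unit (compact_operators E).
Proof.
(* [G] may be empty; the default value 0 lies in every submodule, so it is harmless. *)
move=> [G cG gG]; have [g Gg _] := countable_enum (0 : E) cG.
have g_gen : generating_set (range g).
  apply/seteqP; split => // x _ M [cM gM].
  have : generated_closed_submodule G x by rewrite gG.
  by apply; split => // y /Gg[n <-]; apply: gM; exists n.
have [r rP] := choice (fun n => resolvent_exists (frame_op_pos g n)
  (frame_op_upper g n)).
exists nat, (fun i j => (i <= j)%N), (fun n => frame_op g n ** r n); split.
- exact: directed_leq.
- exact: countableP.
- exact: frame_approximate_unit.
Qed.

Theorem corollary4p6 (R : realType) (A : locallyCStarType R)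
    (E : hilbertModType A) (hA : frechet A) :
  countably_generated E <->
  has_countable_approximate_unit (compact_operators E).
Proof.
split; first exact: generated_countable_unit.
exact: countable_unit_generated.
Qed.
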